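(* Let $\mathbb{K}=\mathbb{R}$ or $\mathbb{C}$ and let $\mathbf{y}=(\mathbf{y}_1,\ldots,\mathbf{y}_m)\in\mathbb{K}^m\setminus\overline{\mathbb{Q}}^m$. Denote by $\Bbbk$ the field extension of $\mathbb{Q}$ generated by the components $\mathbf{y}_i$ of $\mathbf{y}$. The field $\Bbbk$ is a primitive extension of a finitely generated purely transcendental field extension of $\mathbb{Q}$: write $\Bbbk=\mathbb{Q}(\mathbf{t}_1,\ldots,\mathbf{t}_r)(\mathbf{z})$, where the $\mathbf{t}_i\in\mathbb{K}$ are algebraically independent over $\mathbb{Q}$ and $\mathbf{z}\in\mathbb{K}$ is finite of degree $d$ over $\mathbb{Q}(\mathbf{t}_1,\ldots,\mathbf{t}_r)$. Then there exist an open, connected and non-empty neighborhood $\mathcal{U}\subset\mathbb{K}^r$ of $\mathbf{t}=(\mathbf{t}_1,\ldots,\mathbf{t}_r)$, a vector function $y(t,z)\in\mathbb{Q}(t)[z]^m$, $t=(t_1,\ldots,t_r)$, well defined on $\mathcal{U}\times\mathbb{K}$, and a scalar function $z(t)\in\operatorname{QA}(\mathcal{U})$ such that $$\mathbf{z}=z(\mathbf{t}),\qquad \mathbf{y}=y(\mathbf{t},\mathbf{z}),$$ and for every $p$ and every $f\in\mathbb{Q}[y]^p$, where $y=(y_1,\ldots,y_m)$ is a vector of indeterminates, such that $f(\mathbf{y})=0$, we have $$f(y(t,z(t)))=0\quad\text{for all } t\in\mathcal{U}.$$ Moreover, the function $z(t)$ is algebraic of degree $d$ over $\mathbb{Q}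(t)$.
   Context: $\overline{\mathbb{Q}}$ is the field of algebraic numbers in $\mathbb{C}$. For a non-empty open set $\Omega\subset\mathbb{K}^r$, a $\mathbb{K}$-valued $\mathbb{K}$-analytic function $\varphi$ on $\Omega$ is a Nash function if for each $a\in\Omega$ there are an open neighborhood $U\subset\Omega$ of $a$ and a nonzero polynomial $P\in\mathbb{K}[t_1,\ldots,t_r,z]$ with $P(\mathbf{s},\varphi(\mathbf{s}))=0$ for all $\mathbf{s}\in U$. $\operatorname{QA}(\Omega)$ denotes the set of $\mathbb{Q}$-algebraic Nash functions on $\Omega$, i.e. those that are (locally) algebraic over $\mathbb{Q}[t]$: they satisfy a relation $P(\mathbf{s},\varphi(\mathbf{s}))=0$ for $\mathbf{s}\in\Omega$ with $P\in\mathbb{Q}[t_1,\ldots,t_r,z]$, $P\neq0$ (when $\Omega$ is connected, one such polynomial $P$ works on all of $\Omega$). *)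

(* Defs.v *)
From HB Require Import structures.
From mathcomp Require Import all_boot all_order all_algebra finmap.
From mathcomp Require Export complex.
From mathcomp Require Import all_classical all_reals all_analysis.
From mathcomp Require summability mpoly.
(* The notations of mpoly clash with those of MathComp-Analysis. *)
Import -(notations) mpoly.

Set Implicit Arguments.
Unset Strict Implicit.
Unset Printing Implicit Defensive.

Import Order.TTheory GRing.Theory Num.Theory numFieldNormedType.Exports.

Local Open Scope classical_set_scope.
Local Open Scope ring_scope.

Notation "{ 'mpoly' R [ n ] }" := (mpoly n R)
  (at level 0, R at level 2, n at level 2, format "{ 'mpoly'  R [ n ] }").

Definition Qfrac (r : nat) : fieldType := {fraction {mpoly rat[r]}}.

(* I is a set of annihilating polynomials; the minimal polynomial, i.e. the monic
   member of I of least degree among the nonzero ones, has degree d. *)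
Definition minpoly_degree (F : fieldType) (I : set {poly F}) (d : nat) : Prop :=
  (exists p : {poly F}, [/\ p \is monic, I p & size p = d.+1]) /\
  (forall p : {poly F}, I p -> p != 0 -> (d < size p)%N).

Section Fields.
Variable K : numFieldType.

Definition adjoin (F S : set K) : set K :=
  smallest [set A : set K | divring_closed (mem A)] (F `|` S).

Definition Qset : set K := range (ratr : rat -> K).

Definition entries (n : nat) (v : 'rV[K]_n) : set K :=
  range (fun i : 'I_n => v 0 i).

Definition mevalK (n : nat) (p : {mpoly K[n]}) (v : 'rV[K]_n) : K :=
  meval (fun i => v 0 i) p.

Definition mevalQ (n : nat) (p : {mpoly rat[n]}) (v : 'rV[K]_n) : K :=
  mevalK (map_mpoly ratr p) v.

Definition alg_independent (r : nat) (t : 'rV[K]_r) : Prop :=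
  forall p : {mpoly rat[r]}, mevalQ p t = 0 -> p = 0.

Definition degree_over (F : set K) (z : K) (d : nat) : Prop :=
  minpoly_degree [set p : {poly K} | (forall i, F p`_i) /\ root p z] d.

Definition primitive_presentation (k : set K) (r : nat) (t : 'rV[K]_r) (z : K)
    (d : nat) : Prop :=
  [/\ alg_independent t,
      degree_over (adjoin Qset (entries t)) z d &
      k = adjoin (adjoin Qset (entries t)) [set z]].

End Fields.

Arguments Qset K : clear implicits.

Section RationalFunctions.
Variables (K : numFieldType) (r : nat).

Definition frac_value (q : Qfrac r) (s : 'rV[K]_r) (v : K) : Prop :=
  exists n d : {mpoly rat[r]},
    [/\ mevalQ d s != 0, q = tofrac n / tofrac d & v = mevalQ n s / mevalQ d s].

Definition regular_at (q : Qfrac r) (s : 'rV[K]_r) : Prop :=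
  exists v, frac_value q s v.

(* Junk value 0 where q is not regular. *)
Definition frac_eval (q : Qfrac r) (s : 'rV[K]_r) : K :=
  xget 0 [set v | frac_value q s v].

Definition poly_regular_at (P : {poly Qfrac r}) (s : 'rV[K]_r) : Prop :=
  forall i, regular_at P`_i s.

(* The value at (s, w) of an element of Q(t)[z]. *)
Definition poly_frac_eval (P : {poly Qfrac r}) (s : 'rV[K]_r) (w : K) : K :=
  (map_poly (frac_eval^~ s) P).[w].

Lemma frac_value_unique (q : Qfrac r) (s : 'rV[K]_r) (v w : K) :
  frac_value q s v -> frac_value q s w -> v = w.
Proof.
move=> [n [d [ds -> ->]]] [n' [d' [d's + ->]]].
have nz (e : {mpoly rat[r]}) : mevalQ e s != 0 -> tofrac e != 0.
  apply: contraNneq => /eqP; rewrite tofrac_eq0 => /eqP ->.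
  by rewrite /mevalQ /mevalK !rmorph0.
move/eqP; rewrite eqr_div ?nz// -!tofracM tofrac_eq => /eqP.
move=> /(congr1 (fun p => mevalQ p s)); rewrite /mevalQ /mevalK !rmorphM /= => E.
by apply/eqP; rewrite eqr_div// E.
Qed.

Lemma frac_eval_div (n d : {mpoly rat[r]}) (s : 'rV[K]_r) : mevalQ d s != 0 ->
  frac_eval (tofrac n / tofrac d) s = mevalQ n s / mevalQ d s.
Proof.
move=> ds; have h : frac_value (tofrac n / tofrac d) s (mevalQ n s / mevalQ d s).
  by exists n, d.
rewrite /frac_eval; case: xgetP => [v _ hv|/(_ _ h)//].
exact: frac_value_unique hv h.
Qed.

End RationalFunctions.

Section Nash.
Variables (K : numFieldType) (r : nat).

Definition monomial_at (v : 'rV[K]_r) (alpha : {ffun 'I_r -> nat}) : K :=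
  \prod_(i < r) v 0 i ^+ alpha i.

(* Near each point of U, phi is the sum of a power series; the sum over the
   multi-indices alpha is the unconditional one, i.e. the limit of the partial
   sums along the directed set of finite sets of multi-indices. *)
Definition analytic_on (U : set 'rV[K]_r) (phi : 'rV[K]_r -> K) : Prop :=
  forall a, U a -> exists c : {ffun 'I_r -> nat} -> K, \forall s \near a,
    summability.partial_sum
      (fun alpha => c alpha * monomial_at (s - a) alpha)
      @ summability.totally --> phi s.

(* K[t_1, ..., t_r, z] is taken as K[t_1, ..., t_r][z]. *)
Definition nash (U : set 'rV[K]_r) (phi : 'rV[K]_r -> K) : Prop :=
  analytic_on U phi /\
  forall a, U a -> exists V : set 'rV[K]_r, [/\ open_nbhs a V, V `<=` U &
    exists2 P : {poly {mpoly K[r]}}, P != 0 &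
      forall s, V s -> (map_poly (fun c => mevalK c s) P).[phi s] = 0].

Definition QA (U : set 'rV[K]_r) (phi : 'rV[K]_r -> K) : Prop :=
  nash U phi /\
  forall a, U a -> exists V : set 'rV[K]_r, [/\ open_nbhs a V, V `<=` U &
    exists2 P : {poly {mpoly rat[r]}}, P != 0 &
      forall s, V s -> (map_poly (fun c => mevalQ c s) P).[phi s] = 0].

(* The relation P(t, phi(t)) = 0, for P over Q(t), is tested at the points of U
   that are not poles of the coefficients of P. *)
Definition function_degree (U : set 'rV[K]_r) (phi : 'rV[K]_r -> K) (d : nat) :
    Prop :=
  minpoly_degree [set P : {poly Qfrac r} | forall s, U s ->
    poly_regular_at P s -> poly_frac_eval P s (phi s) = 0] d.

End Nash.

(* Main.v *)
(* By algebraic independence, evaluation at the point t embeds the field of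
   rational functions Q(t) in K, so the minimal polynomial M of z and the
   coordinates of y, which are polynomials in z, lift to Q(t)[z].  As z is a
   simple root of M at the point t, the implicit function theorem gives an
   analytic root zf(s) of M for s near t.  A relation f(y) = 0 makes f(Y(t, z))
   divisible by M over Q(t), with denominators that do not vanish near t, and so
   it persists along zf.  The degree of zf is tested at the point t itself.

   The implicit function theorem comes from the Newton iteration with a fixed
   slope, run in the ring of polynomials in the parameters with a weighted l^1
   norm: the iterates converge coefficientwise, and their limit is the power
   series of the solution.

   A presentation of Q(y) is built by adding the y_j one at a time, a
   transcendental one to the t_i, an algebraic one to z by the primitive element
   theorem. *)

Require Import Defs.
From HB Require Import structures.
From mathcomp Require Import all_boot all_order all_algebra finmap.
From mathcomp Require Import complex.
From mathcomp Require Import all_classical all_reals all_analysis.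
From mathcomp Require Import ring separable.
From mathcomp Require mpoly summability.
Import -(notations) mpoly.

Set Implicit Arguments.
Unset Strict Implicit.
Unset Printing Implicit Defensive.

Import Order.TTheory GRing.Theory Num.Theory numFieldNormedType.Exports.

Local Open Scope classical_set_scope.
Local Open Scope ring_scope.

(** * Rational functions at an algebraically independent point *)

Section Adjoin.
Variable K : numFieldType.
Implicit Types (F S A : set K) (x y : K).

Definition subfield A := divring_closed (mem A).

Lemma subfieldP A : subfield A <->
  [/\ A 1, (forall x y, A x -> A y -> A (x - y)) &
    (forall x y, A x -> A y -> A (x / y))].
Proof.
have E x : (x \in mem A) = (x \in A) by [].
split=> [[]|[A1 AB AD]].
  rewrite E in_setE => A1 AB AD; split=> // x y.
    by move: (AB x y); rewrite !E !in_setE.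
  by move: (AD x y); rewrite !E !in_setE.
by split=> [|x y|x y]; rewrite !E !in_setE//; [exact: AB|exact: AD].
Qed.

Lemma subfield_adjoin F S : subfield (adjoin F S).
Proof.
apply/subfieldP; split=> [A [/subfieldP[]//]|x y xA yA A FA|x y xA yA A FA].
  by have [/subfieldP[_ AB _] _] := FA; apply: AB; [exact: xA|exact: yA].
by have [/subfieldP[_ _ AD] _] := FA; apply: AD; [exact: xA|exact: yA].
Qed.

Lemma sub_adjoin_base F S : F `<=` adjoin F S.
Proof. by move=> x Fx A [_]; apply; left. Qed.

Lemma sub_adjoin_gen F S : S `<=` adjoin F S.
Proof. by move=> x Sx A [_]; apply; right. Qed.

Lemma adjoin_sub F S A : subfield A -> F `<=` A -> S `<=` A -> adjoin F S `<=` A.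
Proof. by move=> AA FA SA x; apply; split=> // y [/FA|/SA]. Qed.

Section Closure.
Variable A : set K.
Hypothesis AA : subfield A.

Lemma subfield1 : A 1. Proof. by have /subfieldP[] := AA. Qed.

Lemma subfieldB x y : A x -> A y -> A (x - y).
Proof. by have /subfieldP[_ + _] := AA; apply. Qed.

Lemma subfield_div x y : A x -> A y -> A (x / y).
Proof. by have /subfieldP[_ _] := AA; apply. Qed.

Lemma subfield0 : A 0.
Proof. by rewrite -(subrr 1); apply: subfieldB; exact: subfield1. Qed.

Lemma subfieldD x y : A x -> A y -> A (x + y).
Proof.
move=> Ax Ay; rewrite -(opprK y) -[- y]add0r.
by apply: subfieldB => //; apply: subfieldB => //; exact: subfield0.
Qed.

Lemma subfieldM x y : A x -> A y -> A (x * y).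
Proof.
move=> Ax Ay; rewrite -(invrK y) -[y^-1]mul1r.
by apply: subfield_div => //; apply: subfield_div => //; exact: subfield1.
Qed.

Lemma subfieldX x n : A x -> A (x ^+ n).
Proof.
move=> Ax; elim: n => [|n IH]; first exact: subfield1.
by rewrite exprS; exact: subfieldM.
Qed.

Lemma subfield_sum I (r : seq I) (P : pred I) (E : I -> K) :
  (forall i, A (E i)) -> A (\sum_(i <- r | P i) E i).
Proof. by move=> AE; apply: big_ind => //; [exact: subfield0|exact: subfieldD]. Qed.

Lemma subfield_prod I (r : seq I) (P : pred I) (E : I -> K) :
  (forall i, A (E i)) -> A (\prod_(i <- r | P i) E i).
Proof. by move=> AE; apply: big_ind => //; [exact: subfield1|exact: subfieldM]. Qed.

Lemma subfield_horner (p : {poly K}) x : (forall i, A p`_i) -> A x -> A p.[x].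
Proof.
by move=> Ap Ax; rewrite horner_coef; apply: subfield_sum => i;
  apply: subfieldM => //; exact: subfieldX.
Qed.

End Closure.

End Adjoin.

(* The embedding Q[t] -> Q(t); its codomain carries the canonical structures of
   Qfrac r itself, which are not syntactically those of {fraction _}. *)
Definition qfrac (r : nat) (p : {mpoly rat[r]}) : Qfrac r := tofrac p.

HB.instance Definition _ r := GRing.isZmodMorphism.Build
  {mpoly rat[r]} (Qfrac r) (@qfrac r) (@tofracB _).
HB.instance Definition _ r := GRing.isMonoidMorphism.Build
  {mpoly rat[r]} (Qfrac r) (@qfrac r) (conj (@tofrac1 _) (@tofracM _)).

Lemma qfrac_eq0 r (p : {mpoly rat[r]}) : (qfrac p == 0) = (p == 0).
Proof. exact: tofrac_eq0. Qed.

Section RationalValues.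
Variables (K : numFieldType) (r : nat).
Implicit Types (s t : 'rV[K]_r) (q : Qfrac r) (p : {mpoly rat[r]}).

Definition evalQ s p : K := mevalQ p s.

Lemma evalQ_is_zmod_morphism s : zmod_morphism (evalQ s).
Proof. by move=> p q; rewrite /evalQ /mevalQ /mevalK !rmorphB. Qed.

Lemma evalQ_is_monoid_morphism s : monoid_morphism (evalQ s).
Proof.
by split=> [|p q]; rewrite /evalQ /mevalQ /mevalK ?rmorph1 ?rmorphM.
Qed.

HB.instance Definition _ s := GRing.isZmodMorphism.Build _ _ (evalQ s)
  (evalQ_is_zmod_morphism s).
HB.instance Definition _ s := GRing.isMonoidMorphism.Build _ _ (evalQ s)
  (evalQ_is_monoid_morphism s).

Lemma evalQC s (c : rat) : evalQ s (mpolyC r c) = ratr c.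
Proof. by rewrite /evalQ /mevalQ /mevalK map_mpolyC mevalC. Qed.

Lemma evalQX s i : evalQ s (mpolyX rat (mnm1 i)) = s 0 i.
Proof. by rewrite /evalQ /mevalQ /mevalK map_mpolyX mevalXU. Qed.

Lemma evalQE s p :
  evalQ s p = \sum_(m <- msupp p) ratr (mcoeff m p) * \prod_i s 0 i ^+ m i.
Proof.
rewrite {1}[p]mpolyE rmorph_sum; apply: eq_bigr => m _ /=.
rewrite -mul_mpolyC [LHS](rmorphM (evalQ s)) /= evalQC; congr (_ * _).
by rewrite /evalQ /mevalQ /mevalK map_mpolyX mevalX.
Qed.

Lemma qfrac_repr q : exists n d, d != 0 /\ q = qfrac n / qfrac d.
Proof.
elim/quotW: q => q; exists (frac q).1, (frac q).2.
split; first exact: denom_ratioP.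
(* Once the operations are pushed to representatives, the claim is an equivalence of two ratios,
   that is, a cross-multiplication. *)
rewrite -[RHS]/(FracField.mul (tofrac _) (FracField.inv (tofrac _))) !piE.
have q2 := denom_ratioP q.
apply/eqmodP; rewrite /= FracField.equivfE /FracField.mulf /FracField.invf /=.
by rewrite !numden_Ratio ?mulf_neq0 ?oner_neq0 ?mulr1 ?mul1r // mulrC.
Qed.

Lemma frac_eval_qfrac p d s : evalQ s d != 0 ->
  frac_eval (qfrac p / qfrac d) s = evalQ s p / evalQ s d.
Proof. exact: frac_eval_div. Qed.

End RationalValues.

(** * Common denominators for polynomials over [Q(t)] *)

Section Denominators.
Variables (K : numFieldType) (r : nat).
Implicit Types (s t : 'rV[K]_r) (q : Qfrac r) (p : {mpoly rat[r]}).
Implicit Types (P : {poly {mpoly rat[r]}}) (Q : {poly Qfrac r}).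

(** Every polynomial over [Q(t)] has this shape. It confines the poles to the hypersurface [e = 0]
    and reduces evaluation to polynomials over [Q[t]], where evaluation at any point is a
    morphism. *)
Definition over_denom (e : {mpoly rat[r]}) P : {poly Qfrac r} :=
  (qfrac e)^-1 *: map_poly (@qfrac r) P.

Lemma over_denom_regular e P s : evalQ s e != 0 ->
  poly_regular_at (over_denom e P) s.
Proof.
move=> es i; exists (evalQ s P`_i / evalQ s e), P`_i, e; split=> //.
by rewrite coefZ coef_map /= mulrC.
Qed.

Lemma over_denom_eval e P s w : evalQ s e != 0 ->
  poly_frac_eval (over_denom e P) s w =
  (map_poly (evalQ s) P).[w] / evalQ s e.
Proof.
move=> es; rewrite /poly_frac_eval.
(* At an arbitrary [s] the map [frac_eval] need not be a morphism, because of the default value at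
   poles; the value at 0 is all that [coef_map_id0] requires. *)
have ev0 : frac_eval (0 : Qfrac r) s = 0.
  have -> : (0 : Qfrac r) = qfrac 0 / qfrac e by rewrite rmorph0 mul0r.
  by rewrite frac_eval_qfrac// rmorph0 mul0r.
suff -> : map_poly (fun q => frac_eval q s) (over_denom e P) =
    (evalQ s e)^-1 *: map_poly (evalQ s) P by rewrite hornerZ mulrC.
apply/polyP => i; rewrite coef_map_id0// !coefZ !coef_map /= mulrC.
by rewrite frac_eval_qfrac// mulrC.
Qed.

Lemma over_denomM e e' P : e' != 0 ->
  over_denom (e * e') (e' *: P) = over_denom e P.
Proof.
move=> e'0; apply/polyP => i; rewrite !coefZ !coef_map /= coefZ !rmorphM /=.
by rewrite invfM -mulrA mulKf// qfrac_eq0.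
Qed.

Lemma over_denom_exists Q : exists2 e, e != 0 & exists P, Q = over_denom e P.
Proof.
elim/poly_ind: Q => [|Q c [e e0 [P ->]]].
  by exists 1; rewrite ?oner_neq0//; exists 0; rewrite /over_denom map_poly0 scaler0.
have [n [d [d0 ->]]] := qfrac_repr c.
exists (e * d); first by rewrite mulf_neq0.
exists (d *: (P * 'X) + (e * n)%:P).
rewrite /over_denom rmorphD /= map_polyC scalerDr /=; congr (_ + _).
  rewrite -[RHS]/(over_denom (e * d) (d *: (P * 'X))) over_denomM// /over_denom.
  by rewrite rmorphM /= map_polyX scalerAl.
rewrite -mul_polyC -polyCM; congr (_%:P); rewrite !rmorphM /= invfM.
by rewrite mulrACA mulVf ?qfrac_eq0// mul1r mulrC.
Qed.

(** The product of the individual denominators serves for all; each numerator is multiplied by the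
    other factors. *)
Lemma over_denom_family (I : finType) (F : I -> {poly Qfrac r}) :
  exists2 e, e != 0 & exists G, forall i, F i = over_denom e (G i).
Proof.
have /boolp.choice[f fP] i : exists eP, eP.1 != 0 /\ F i = over_denom eP.1 eP.2.
  by have [e e0 [P FP]] := over_denom_exists (F i); exists (e, P).
exists (\prod_i (f i).1); first by apply/prodf_neq0 => i _; have [] := fP i.
exists (fun i => (\prod_(j | j != i) (f j).1) *: (f i).2) => i.
rewrite (bigD1 i)//= over_denomM; first by have [] := fP i.
by apply/prodf_neq0 => j _; have [] := fP j.
Qed.

End Denominators.

(** * The embedding of [Q(t)] in [K] by evaluation at an independent point *)

Section Embedding.
Variables (K : numFieldType) (r : nat) (t : 'rV[K]_r).
Hypothesis t_free : alg_independent t.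
Implicit Types (q : Qfrac r) (p : {mpoly rat[r]}).

Lemma evalQ_neq0 p : p != 0 -> evalQ t p != 0.
Proof. by apply: contra_neq; exact: t_free. Qed.

(* The proof of independence is an argument so that the morphism structure of
   this map can be inferred. *)
Definition frac_emb of alg_independent t := fun q : Qfrac r => frac_eval q t.
Local Notation iota := (frac_emb t_free).

(** By independence no nonzero denominator vanishes at [t], so the default value of [frac_eval]
    never occurs there. Additivity and multiplicativity on all of [Q(t)] rest on this. *)
Lemma frac_embE n d : d != 0 -> iota (qfrac n / qfrac d) = evalQ t n / evalQ t d.
Proof. by move=> d0; rewrite [LHS]frac_eval_qfrac//; exact: evalQ_neq0. Qed.

Lemma frac_emb_qfrac p : iota (qfrac p) = evalQ t p.
Proof.
by have := frac_embE p (oner_neq0 _); rewrite !rmorph1 !divr1.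
Qed.

Lemma frac_emb_is_zmod_morphism : zmod_morphism iota.
Proof.
move=> x y; have [n [d [d0 ->]]] := qfrac_repr x.
have [n' [d' [d'0 ->]]] := qfrac_repr y.
have dt := evalQ_neq0 d0; have d't := evalQ_neq0 d'0.
rewrite -mulNr addf_div ?qfrac_eq0// -rmorphN /= -!rmorphM -rmorphD /=.
rewrite !frac_embE ?mulf_neq0// rmorphD !rmorphM rmorphN /=.
by rewrite -mulNr addf_div.
Qed.

Lemma frac_emb_is_monoid_morphism : monoid_morphism iota.
Proof.
split=> [|x y]; first by rewrite -(rmorph1 (@qfrac r)) frac_emb_qfrac rmorph1.
have [n [d [d0 ->]]] := qfrac_repr x; have [n' [d' [d'0 ->]]] := qfrac_repr y.
by rewrite mulf_div -!rmorphM /= !frac_embE ?mulf_neq0// !rmorphM mulf_div.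
Qed.

End Embedding.

HB.instance Definition _ K r t t_free := GRing.isZmodMorphism.Build _ _
  (@frac_emb K r t t_free) (@frac_emb_is_zmod_morphism K r t t_free).
HB.instance Definition _ K r t t_free := GRing.isMonoidMorphism.Build _ _
  (@frac_emb K r t t_free) (@frac_emb_is_monoid_morphism K r t t_free).

(** * Minimal polynomials over [Q(t)] and the field generated by a root *)

Section Presentation.
Variables (K : numFieldType) (r : nat) (t : 'rV[K]_r).
Hypothesis t_free : alg_independent t.
Local Notation iota := (frac_emb t_free).
Implicit Types (z : K) (M p : {poly Qfrac r}).

Lemma subfield_range : subfield (range iota).
Proof.
apply/subfieldP; split=> [|_ _ [x _ <-] [y _ <-]|_ _ [x _ <-] [y _ <-]].
- by exists 1; rewrite ?rmorph1.
- by exists (x - y); rewrite ?rmorphB.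
- by exists (x / y); rewrite ?fmorph_div.
Qed.

Lemma subfield_ratr (A : set K) (c : rat) : subfield A -> A (ratr c).
Proof.
move=> AA; rewrite -(divq_num_den c) fmorph_div /= !rmorph_int.
have An n : A n%:R.
  elim: n => [|n IH]; first exact: subfield0.
  by rewrite -natr1; apply: subfieldD => //; exact: subfield1.
have Az (n : int) : A n%:~R.
  case: n => n; first exact: An.
  by rewrite NegzE mulrNz -sub0r; apply: subfieldB => //; [exact: subfield0|exact: An].
exact: subfield_div.
Qed.

Lemma evalQ_subfield (A : set K) (p : {mpoly rat[r]}) : subfield A -> entries t `<=` A ->
  A (evalQ t p).
Proof.
move=> AA At; rewrite evalQE; apply: subfield_sum => // m.
apply: subfieldM => //; first exact: subfield_ratr.
apply: subfield_prod => // i; apply: subfieldX => //; apply: At.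
by exists i.
Qed.

(** This exchanges the subfield of [K] for the image of a morphism, so that polynomials with
    coefficients in it lift to [{poly Qfrac r}]. *)
Lemma adjoin_range : adjoin (Qset K) (entries t) = range iota.
Proof.
apply/seteqP; split.
  apply: adjoin_sub; first exact: subfield_range.
    move=> _ [c _ <-]; exists (qfrac (mpolyC r c)) => //.
    by rewrite frac_emb_qfrac evalQC.
  move=> _ [i _ <-]; exists (qfrac (mpolyX rat (mnm1 i))) => //.
  by rewrite frac_emb_qfrac evalQX.
move=> _ [q _ <-]; have [n [d [d0 ->]]] := qfrac_repr q.
rewrite frac_embE//; apply: (subfield_div (subfield_adjoin _ _)).
  by apply: evalQ_subfield; [exact: subfield_adjoin|exact: sub_adjoin_gen].
by apply: evalQ_subfield; [exact: subfield_adjoin|exact: sub_adjoin_gen].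
Qed.

(** The minimal polynomial of [z], kept over the abstract field [Qfrac r] and not over its image in
    [K], so that its coefficients can be evaluated at points other than [t]. *)
Definition minimal_over z (M : {poly Qfrac r}) :=
  [/\ M \is monic, root (map_poly iota M) z &
   forall p, p != 0 -> root (map_poly iota p) z -> (size M <= size p)%N].

Lemma lift_range (p : {poly K}) : (forall i, range iota p`_i) ->
  exists q, p = map_poly iota q.
Proof.
move=> pF; have /boolp.choice[f fp] i : exists q, iota q = p`_i.
  by have [q _ <-] := pF i; exists q.
exists (\poly_(i < size p) f i).
apply/polyP => i; rewrite coef_map coef_poly; case: ltnP => [_|pi].
  exact/esym/fp.
by rewrite nth_default//; apply/esym; exact: (rmorph0 iota).
Qed.

Lemma degree_overP z d :
  degree_over (adjoin (Qset K) (entries t)) z d <->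
  exists2 M, minimal_over z M & size M = d.+1.
Proof.
rewrite adjoin_range; split=> [[[p [pm [pF pz] sp]] pmin]|[M [Mm Mz Mmin] sM]].
  have [M pM] := lift_range pF; exists M; last by rewrite -sp pM size_map_poly.
  split=> [||q q0 qz]; first by move: pm; rewrite pM map_monic.
    by rewrite -pM.
  rewrite -(size_map_poly iota M) -pM sp -(size_map_poly iota q).
  apply: pmin; last by rewrite map_poly_eq0.
  by split=> // i; exists q`_i => //; rewrite coef_map.
split.
  exists (map_poly iota M); rewrite map_monic size_map_poly; split=> //.
  by split=> // i; exists M`_i => //; rewrite coef_map.
move=> p [/lift_range[q ->] qz]; rewrite map_poly_eq0 size_map_poly => q0.
by rewrite -sM; exact: Mmin.
Qed.

Lemma minimal_exists z p : p != 0 -> root (map_poly iota p) z ->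
  exists M, minimal_over z M.
Proof.
move=> p0 pz; pose P n := `[< exists q : {poly Qfrac r},
  [/\ q != 0, root (map_poly iota q) z & size q = n] >].
have exP : exists n, P n by exists (size p); apply/asboolP; exists p.
case: (ex_minnP exP) => n /asboolP[q [q0 qz sq]] qmin.
have lq : (lead_coef q)^-1 != 0 by rewrite invr_eq0 lead_coef_eq0.
exists ((lead_coef q)^-1 *: q); split.
- by apply/monicP; rewrite lead_coefZ; apply: mulVf; rewrite lead_coef_eq0.
- by rewrite map_polyZ rootZ// fmorph_eq0.
- move=> p' p'0 p'z; rewrite size_scale// sq; apply: qmin.
  by apply/asboolP; exists p'.
Qed.

(** The values at [z] of polynomials already form a field: a polynomial that does not vanish at [z]
    is coprime to [M], and a Bezout relation inverts its value. *)
Lemma adjoin_root z M : minimal_over z M ->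
  adjoin (range iota) [set z] = range (fun p => (map_poly iota p).[z]).
Proof.
move=> Mmin; apply/seteqP; split.
  apply: adjoin_sub.
  - apply/subfieldP; split=> [|_ _ [x _ <-] [y _ <-]|_ _ [x _ <-] [y _ <-]].
    + by exists 1 => //; rewrite rmorph1 hornerC.
    + by exists (x - y) => //; rewrite rmorphB hornerD hornerN.
    (* Division by 0 gives 0, which is the value of the zero polynomial. *)
    + have [yz|yz] := eqVneq (map_poly iota y).[z] 0.
        by exists 0 => //; rewrite yz invr0 mulr0 rmorph0 horner0.
      have [Mm Mz Mle] := Mmin.
      have /Bezout_coprimepP[[u v] /=] : coprimep M y.
        rewrite /coprimep; have g0 : gcdp M y != 0.
          by rewrite gcdp_eq0 negb_and monic_neq0.
        have gM := dvdp_gcdl M y; have gy := dvdp_gcdr M y.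
        (* The gcd divides [y], hence does not vanish at [z]; so its cofactor in [M] does, and
           minimality of [M] forces the gcd to be constant. *)
        have gz : ~~ root (map_poly iota (gcdp M y)) z.
          apply: contraNN yz => gz; move: gy => /dvdpP[w ->].
          by rewrite rmorphM /= hornerM (rootP gz) mulr0.
        move: gM => /dvdpP[h Mh]; have h0 : h != 0.
          by apply: contraTneq (monic_neq0 Mm) => h0; rewrite Mh h0 mul0r eqxx.
        have : root (map_poly iota h) z.
          by move: Mz; rewrite {1}Mh rmorphM /= rootM (negbTE gz) orbF.
        move/(Mle _ h0); rewrite {1}Mh size_mul//.
        move: g0; rewrite -size_poly_gt0; case: (size (gcdp M y)) => // -[|k]//= _.
        by rewrite addnS /= addnS ltnNge leq_addr.
      rewrite -size_poly_eq1 => /size_poly1P[c c0 E].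
      (* At [z] the relation [u * M + v * y = c] reads [v(z) y(z) = c], so [x / y] has the value of
         [x * v / c]. *)
      exists (c^-1 *: (x * v)) => //.
      have : (map_poly iota (u * M + v * y)).[z] = (map_poly iota c%:P).[z] by rewrite E.
      rewrite rmorphD !rmorphM /= hornerD !hornerM (rootP Mz) mulr0 add0r.
      rewrite map_polyC hornerC => E'; rewrite map_polyZ hornerZ rmorphM hornerM fmorphV /= -E' invfM.
      have vz : (map_poly iota v).[z] != 0.
        apply: contra_neq c0 => v0; apply: (fmorph_inj iota).
        by rewrite rmorph0 -E' v0 mul0r.
      by rewrite mulrC mulrA mulfK.
  - by move=> _ [q _ <-]; exists q%:P => //; rewrite map_polyC hornerC.
  - by move=> _ ->; exists 'X => //; rewrite map_polyX hornerX.
move=> _ [p _ <-]; apply: (subfield_horner (subfield_adjoin _ _)).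
  by move=> i; rewrite coef_map; apply: sub_adjoin_base; exists p`_i.
exact: sub_adjoin_gen.
Qed.

End Presentation.

(** * Existence of a presentation *)

Section AddVariable.
Variables (K : numFieldType) (r : nat).
Implicit Types (t : 'rV[K]_r) (x z : K).

Definition snoc_row t x : 'rV[K]_r.+1 :=
  \row_i oapp (fun j => t 0 j) x (unlift ord_max i).

Lemma snoc_row_max t x : snoc_row t x 0 ord_max = x.
Proof. by rewrite mxE unlift_none. Qed.

Lemma snoc_row_widen t x i : snoc_row t x 0 (widen_ord (leqnSn r) i) = t 0 i.
Proof.
have -> : widen_ord (leqnSn r) i = lift ord_max i.
  by apply: val_inj; rewrite /= /bump leqNgt ltn_ord.
by rewrite mxE liftK.
Qed.

(** The values of a ring morphism on rational constants are forced, so only those on the variables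
    remain free. *)
Lemma evalQ_unique (f : {rmorphism {mpoly rat[r]} -> K}) (s : 'rV[K]_r) :
  (forall i, f (mpolyX rat (mnm1 i)) = s 0 i) -> f =1 evalQ s.
Proof.
move=> fX p; rewrite evalQE [p in LHS]mpolyE rmorph_sum; apply: eq_bigr => m _ /=.
rewrite -mul_mpolyC [LHS](rmorphM f); congr (_ * _).
  exact: (fmorph_eq_rat (f \o @mpolyC r _)).
rewrite mpolyXE_id rmorph_prod; apply: eq_bigr => i _ /=.
by rewrite rmorphXn fX.
Qed.

Lemma evalQ_mwiden t x p : evalQ (snoc_row t x) (mwiden p) = evalQ t p.
Proof.
apply: (evalQ_unique (f := evalQ (snoc_row t x) \o @mwiden r _)) => i /=.
by rewrite mwidenX mnmwiden1 evalQX snoc_row_widen.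
Qed.

Lemma evalQ_muni t x p :
  evalQ (snoc_row t x) p = (map_poly (evalQ t) (muni p)).[x].
Proof.
rewrite evalQE muniE rmorph_sum horner_sum; apply: eq_bigr => m _ /=.
rewrite map_polyZ map_polyXn hornerZ hornerXn -mul_mpolyC rmorphM /= evalQC.
rewrite big_ord_recr /= snoc_row_max mulrA; congr (_ * _ * _).
rewrite mpolyXE_id rmorph_prod; apply: eq_bigr => i _ /=.
by rewrite rmorphXn /= evalQX snoc_row_widen mnmE.
Qed.

Let trunc (m : multinom r.+1) : multinom r :=
  Multinom [tuple m (widen_ord (leqnSn r) i) | i < r].

(** A multi-index amounts to its truncation and its last exponent, so each coefficient of a
    polynomial can be read off its image under [muni]. *)
Lemma muni_inj : injective (@muni r rat).
Proof.
move=> p q pq; apply/mpolyP => m.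
suff E (u : {mpoly rat[r.+1]}) : mcoeff m u = mcoeff (trunc m) (muni u)`_(m ord_max).
  by rewrite !E pq.
rewrite muniE coef_sum [u in LHS]mpolyE !raddf_sum; apply: eq_bigr => m' _ /=.
rewrite mcoeffZ mcoeffX coefZ coefXn -!mul_mpolyC -mulrA.
rewrite mcoeffCM; congr (_ * _).
have -> : (m' == m) = (trunc m' == trunc m) && (m ord_max == m' ord_max).
  apply/idP/andP => [/eqP ->|[/eqP mE /eqP Emax]]; first by split; exact: eqxx.
  apply/eqP/mnmP => i; have E j : trunc m' j = trunc m j by rewrite mE.
  case: (unliftP ord_max i) => [j|] ->; last exact/esym.
  have -> : lift ord_max j = widen_ord (leqnSn r) j.
    by apply: val_inj; rewrite /= /bump leqNgt ltn_ord.
  by have := E j; rewrite !mnmE.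
case: (m ord_max == _); last by rewrite andbF mulr0 mcoeff0.
by rewrite andbT mulr1 mcoeffX.
Qed.

Lemma snoc_free t x : alg_independent t ->
  (forall P : {poly {mpoly rat[r]}}, P != 0 -> (map_poly (evalQ t) P).[x] != 0) ->
  alg_independent (snoc_row t x).
Proof.
move=> t_free x_transc p; rewrite -/(evalQ _ p) evalQ_muni => p0.
apply: muni_inj; rewrite raddf0; apply: contra_eq p0; exact: x_transc.
Qed.

End AddVariable.

(** * Induction on the list of generators *)

Section Existence.
Variable K : numFieldType.
Implicit Types (l : seq K) (x z : K).

(** Denominators are cleared. The form over [Q[t]] does not mention the embedding, hence is easily
    carried to a longer [t]. *)
Lemma poly_over_mpoly r (t : 'rV[K]_r) (t_free : alg_independent t) z
    (p : {poly Qfrac r}) : p != 0 -> root (map_poly (frac_emb t_free) p) z ->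
  exists2 P : {poly {mpoly rat[r]}}, P != 0 & root (map_poly (evalQ t) P) z.
Proof.
have [e e0 [P ->]] := over_denom_exists p => p0 pz; exists P.
  by apply: contra_neq p0 => ->; rewrite /over_denom rmorph0 scaler0.
move: pz; rewrite /over_denom map_polyZ rootZ; last first.
  by rewrite fmorph_eq0 invr_eq0 qfrac_eq0.
rewrite -map_poly_comp; congr (root _ z); apply: eq_map_poly => q /=.
exact: frac_emb_qfrac.
Qed.

Lemma mpoly_over_poly r (t : 'rV[K]_r) (t_free : alg_independent t) z
    (P : {poly {mpoly rat[r]}}) : P != 0 -> root (map_poly (evalQ t) P) z ->
  exists2 p : {poly Qfrac r}, p != 0 & root (map_poly (frac_emb t_free) p) z.
Proof.
move=> P0 Pz; exists (map_poly (@qfrac r) P).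
  apply: contra_neq P0 => /polyP P0; apply/polyP => i; have := P0 i.
  by rewrite coef_map !coef0 => /eqP; rewrite qfrac_eq0 => /eqP.
rewrite -map_poly_comp; move: Pz; congr (root _ z); apply: eq_map_poly => q /=.
exact/esym/frac_emb_qfrac.
Qed.

(** The induction carries only the algebraicity of [z] over [Q[t]]; a minimal polynomial, and with
    it the degree, is chosen at the end. *)
Lemma presentation_of_algebraic l : exists r (t : 'rV[K]_r) z,
  [/\ alg_independent t,
      exists2 P : {poly {mpoly rat[r]}}, P != 0 & root (map_poly (evalQ t) P) z &
      adjoin (Qset K) [set` l] =
      adjoin (adjoin (Qset K) (entries t)) [set z]].
Proof.
elim: l => [|x l [r [t [z [t_free [P P0 Pz] El]]]]].
  exists 0, 0, 0; split.
  - move=> p; rewrite -/(evalQ _ p) -[p](@mpolyKC rat) evalQC.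
    by move/eqP; rewrite fmorph_eq0 => /eqP ->; rewrite mpolyC0.
  - by exists 'X; rewrite ?polyX_eq0// map_polyX rootX.
  - have AA F S := @subfield_adjoin K F S.
    apply/seteqP; split; apply: adjoin_sub => //.
    + by apply: subset_trans (@sub_adjoin_base _ _ _); exact: sub_adjoin_base.
    + apply: adjoin_sub => //; first exact: sub_adjoin_base.
      by move=> ? [[]].
    + by move=> _ ->; exact: subfield0.
have [p p0 pz] := mpoly_over_poly t_free P0 Pz.
have AA F S := @subfield_adjoin K F S.
have sub_xl : adjoin (Qset K) [set` l] `<=` adjoin (Qset K) [set` x :: l].
  apply: adjoin_sub => //; first exact: sub_adjoin_base.
  by move=> y yl; apply: sub_adjoin_gen; rewrite /= inE yl orbT.
have xxl : adjoin (Qset K) [set` x :: l] x.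
  by apply: sub_adjoin_gen; rewrite /= inE eqxx.
have t_xl : adjoin (Qset K) (entries t) `<=` adjoin (Qset K) [set` x :: l].
  by apply: subset_trans sub_xl; rewrite El; exact: sub_adjoin_base.
have z_xl : adjoin (Qset K) [set` x :: l] z.
  by apply: sub_xl; rewrite El; exact: sub_adjoin_gen.
have [[Px Px0 Pxx]|x_transc] := pselect (exists2 P : {poly {mpoly rat[r]}},
    P != 0 & root (map_poly (evalQ t) P) x).
  have [px px0 pxx] := mpoly_over_poly t_free Px0 Pxx.
  have char0 : has_char0 (Qfrac r).
    by move=> q; rewrite -(fmorph_pchar (frac_emb t_free)) pchar_num.
  (* For [x] algebraic: a combination [w] of [z] and [x] is a primitive element, and [f], [g]
     recover [x] and [z] as polynomials in [w]. *)
  have [n /= [[f fE] [g gE]]] := pchar0_PET px0 pxx p0 pz char0.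
  set w := z *+ n - x in fE gE; exists r, t, w; split=> //.
    have alg_w : algebraicOver (frac_emb t_free) w.
      apply: algebraic_sub; last by exists px.
      rewrite -mulr_natr -(rmorph_nat (frac_emb t_free)).
      by apply: algebraic_mul; [exists p|exact: algebraic_id].
    have [pw pw0 pww] := alg_w; exact: poly_over_mpoly pww.
  apply/seteqP; split; apply: adjoin_sub => //.
  - by apply: subset_trans (@sub_adjoin_base _ _ _); exact: sub_adjoin_base.
  - have gen (h : {poly Qfrac r}) : adjoin (adjoin (Qset K) (entries t)) [set w]
        (map_poly (frac_emb t_free) h).[w].
      apply: (subfield_horner (AA _ _)); last exact: sub_adjoin_gen.
      move=> i; apply: sub_adjoin_base; rewrite (adjoin_range t_free) coef_map.
      by exists h`_i.
    move=> y; rewrite /= inE => /orP[/eqP ->|yl]; first by rewrite -fE; exact: gen.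
    have : adjoin (Qset K) [set` l] y by exact: sub_adjoin_gen.
    rewrite El; apply: adjoin_sub => //; first exact: sub_adjoin_base.
    by move=> _ ->; rewrite -gE; exact: gen.
  - move=> _ ->; apply: (subfieldB (AA _ _)) => //; rewrite -mulr_natl.
    apply: (subfieldM (AA _ _)) => //; rewrite -(ratr_nat K); exact: subfield_ratr.
(* For [x] transcendental: it joins the parameters, and [z] keeps its annihilating polynomial, read
   in one more variable. *)
exists r.+1, (snoc_row t x), z; split.
- apply: snoc_free => // Q Q0; apply/negP => Qx; apply: x_transc.
  by exists Q.
- exists (map_poly (@mwiden r rat) P).
    apply: contra_neq P0 => /polyP P0; apply/polyP => i; apply: inj_mwiden.
    by have := P0 i; rewrite coef_map !coef0 mwiden0.
  rewrite -map_poly_comp; move: Pz; congr (root _ z); apply: eq_map_poly => q /=.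
  exact/esym/evalQ_mwiden.
- have st i : entries (snoc_row t x) (t 0 i).
    by exists (widen_ord (leqnSn r) i) => //; exact: snoc_row_widen.
  have sx : entries (snoc_row t x) x.
    by exists ord_max => //; exact: snoc_row_max.
  apply/seteqP; split; apply: adjoin_sub => //.
  + by apply: subset_trans (@sub_adjoin_base _ _ _); exact: sub_adjoin_base.
  + move=> y; rewrite /= inE => /orP[/eqP ->|yl].
      by apply: sub_adjoin_base; exact: sub_adjoin_gen.
    have : adjoin (Qset K) [set` l] y by exact: sub_adjoin_gen.
    rewrite El; apply: adjoin_sub => //; last exact: sub_adjoin_gen.
    apply: subset_trans (@sub_adjoin_base _ _ _).
    apply: adjoin_sub => //; first exact: sub_adjoin_base.
    by move=> _ [i _ <-]; exact: sub_adjoin_gen.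
  + apply: adjoin_sub => //; first exact: sub_adjoin_base.
    move=> _ [i _ <-]; case: (unliftP ord_max i) => [j|] ->.
      rewrite mxE liftK /=; apply: t_xl; apply: sub_adjoin_gen; by exists j.
    by rewrite snoc_row_max.
  + by move=> _ ->.
Qed.

Lemma presentation_exists m (y : 'rV[K]_m) : exists r (t : 'rV[K]_r) z d,
  primitive_presentation (adjoin (Qset K) (entries y)) t z d.
Proof.
have [r [t [z [t_free [P P0 Pz] E]]]] :=
  presentation_of_algebraic (codom (fun i => y 0 i)).
have [p p0 pz] := mpoly_over_poly t_free P0 Pz.
have [M Mmin] := minimal_exists p0 pz.
exists r, t, z, (size M).-1; split => //.
  apply/degree_overP; exists M => //; rewrite prednK// size_poly_gt0.
  by have [/monic_neq0] := Mmin.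
rewrite -E; congr (adjoin _ _); apply/seteqP; split=> x.
  by move=> [i _ <-]; exact: codom_f.
by move=> /codomP[i ->]; exists i.
Qed.

End Existence.

(** * The analytic implicit function theorem *)

Section Seminorm.
Variable K : numFieldType.

(** A common interface for the weighted norms on [{mpoly K[r]}] and the norm of [K], which need the
    same estimates. *)
Definition ring_seminorm (A : comNzRingType) (N : A -> K) :=
  [/\ (forall x, 0 <= N x), N 0 = 0, N 1 <= 1,
      (forall x y, N (x - y) <= N x + N y) &
      (forall x y, N (x * y) <= N x * N y)].

(** The derivative at [d] of the majorant with coefficients [N Q_i]. *)
Definition lipschitz_const (A : comNzRingType) (N : A -> K) (Q : {poly A}) (d : K) : K :=
  \sum_(i < size Q) N Q`_i * (i%:R * d ^+ i.-1).

Section Theory.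
Variables (A : comNzRingType) (N : A -> K).
Hypothesis NN : ring_seminorm N.

Lemma seminorm_ge0 x : 0 <= N x. Proof. by have [] := NN. Qed.

Lemma seminormN x : N (- x) <= N x.
Proof. by have [_ N0 _ NB _] := NN; have := NB 0 x; rewrite sub0r N0 add0r. Qed.

Lemma seminormB x y : N (x - y) <= N x + N y.
Proof. by have [_ _ _ + _] := NN; apply. Qed.

Lemma seminormD x y : N (x + y) <= N x + N y.
Proof.
by rewrite -[y in x + y]opprK (le_trans (seminormB _ _))// lerD2l seminormN.
Qed.

Lemma seminormM x y : N (x * y) <= N x * N y.
Proof. by have [_ _ _ _ +] := NN; apply. Qed.

Lemma seminorm_sum I (r : seq I) (P : pred I) (F : I -> A) :
  N (\sum_(i <- r | P i) F i) <= \sum_(i <- r | P i) N (F i).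
Proof.
elim/big_rec2: _ => [|i y1 y2 _ h]; first by have [_ ->] := NN.
by rewrite (le_trans (seminormD _ _))// lerD2l.
Qed.

Lemma seminormX x n d : N x <= d -> N (x ^+ n) <= d ^+ n.
Proof.
move=> xd; elim: n => [|n IH]; first by have [] := NN.
rewrite !exprS (le_trans (seminormM _ _))// ler_pM ?seminorm_ge0//.
Qed.

(** The quotient of [u^i - v^i] by [u - v] is a sum of [i] products, each of seminorm at most
    [d^(i-1)]. *)
Lemma horner_lipschitz (Q : {poly A}) d u v : N u <= d -> N v <= d ->
  N (Q.[u] - Q.[v]) <= lipschitz_const N Q d * N (u - v).
Proof.
move=> ud vd; have d0 : 0 <= d by apply: le_trans ud; exact: seminorm_ge0.
rewrite !horner_coef -sumrB (le_trans (seminorm_sum _ _ _))// mulr_suml.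
apply: ler_sum => i _; rewrite -mulrBr (le_trans (seminormM _ _))// -mulrA.
rewrite ler_wpM2l ?seminorm_ge0// subrXX mulrC (le_trans (seminormM _ _))//.
rewrite ler_wpM2r ?seminorm_ge0// (le_trans (seminorm_sum _ _ _))//.
have -> : i%:R * d ^+ i.-1 = \sum_(j < i) d ^+ i.-1.
  by rewrite sumr_const card_ord mulr_natl.
apply: ler_sum => j _; rewrite (le_trans (seminormM _ _))//.
have -> : i.-1 = ((i.-1 - j) + j)%N.
  by rewrite subnK// -ltnS prednK// (leq_ltn_trans _ (ltn_ord j)).
by rewrite addnK exprD ler_pM ?seminorm_ge0// seminormX.
Qed.

(** This later keeps the derivative of the Newton map away from 1, so that the root found is again
    simple. *)
Lemma deriv_bound (Q : {poly A}) d w : N w <= d ->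
  N Q^`().[w] <= lipschitz_const N Q d.
Proof.
move=> wd; have d0 : 0 <= d by apply: le_trans wd; exact: seminorm_ge0.
rewrite /lipschitz_const; case sQ: (size Q) => [|n].
  move/eqP: sQ; rewrite size_poly_eq0 => /eqP ->.
  by rewrite deriv0 horner0 big_ord0; have [_ ->] := NN.
rewrite big_ord_recl /= mul0r mulr0 add0r (horner_coef_wide (n := n)); last first.
  by apply/leq_sizeP => j nj; rewrite coef_deriv nth_default ?mul0rn// sQ.
rewrite (le_trans (seminorm_sum _ _ _))//; apply: ler_sum => i _ /=.
rewrite /bump leq0n add1n coef_deriv (le_trans (seminormM _ _))// mulrA.
rewrite ler_pM ?seminorm_ge0//.
  rewrite -[in leLHS]mulr_natr (le_trans (seminormM _ _))// ler_wpM2l ?seminorm_ge0//.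
  elim: i.+1 => [|k IH]; first by rewrite !mulr0n; have [_ ->] := NN.
  by rewrite -natr1 -[in leRHS]natr1 (le_trans (seminormD _ _))// lerD//; have [] := NN.
exact: seminormX.
Qed.

End Theory.

Lemma norm_ring_seminorm : ring_seminorm (fun x : K => `|x|).
Proof.
split=> [//|||x y|x y]; rewrite ?normr0 ?normr1 ?normrM//.
exact: ler_normB.
Qed.

Lemma lipschitz_const_wide (A : comNzRingType) (N : A -> K) (Q : {poly A}) d n :
  N 0 = 0 -> (size Q <= n)%N ->
  lipschitz_const N Q d = \sum_(i < n) N Q`_i * (i%:R * d ^+ i.-1).
Proof.
move=> N0 Qn; rewrite /lipschitz_const.
rewrite (big_ord_widen n (fun i => N Q`_i * (i%:R * d ^+ i.-1)) Qn).
rewrite big_mkcond; apply: eq_bigr => i _; case: ltnP => // Qi.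
by rewrite nth_default// N0 mul0r.
Qed.

(** Applied to the evaluation at a point of the polydisc: the contraction on polynomials then gives
    one on values. *)
Lemma lipschitz_const_le (A B : comNzRingType) (N : A -> K) (N' : B -> K)
    (f : {rmorphism A -> B}) Q d : 0 <= d -> N' 0 = 0 ->
  (forall x, N' (f x) <= N x) ->
  lipschitz_const N' (map_poly f Q) d <= lipschitz_const N Q d.
Proof.
move=> d0 N'0 fN; rewrite (lipschitz_const_wide _ N'0 (size_poly _ _)).
apply: ler_sum => i _; rewrite coef_map ler_wpM2r// ?fN//.
by rewrite mulr_ge0// exprn_ge0.
Qed.

End Seminorm.

(** * The weighted norm on polynomials in the parameters *)

Section WeightedNorm.
Variables (K : numFieldType) (r : nat).
Implicit Types (p q : {mpoly K[r]}) (rho : K) (x : 'rV[K]_r).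

(* The l^1 norm of the coefficients, for the polydisc of radius rho. *)
Definition mnorm rho p : K :=
  \sum_(m <- msupp p) `|mcoeff m p| * rho ^+ mdeg m.

Lemma mnorm_seq rho p (s : seq (multinom r)) : uniq s -> {subset msupp p <= s} ->
  mnorm rho p = \sum_(m <- s) `|mcoeff m p| * rho ^+ mdeg m.
Proof.
move=> us ps; rewrite (bigID (mem (msupp p)))/= [X in _ + X]big1 ?addr0; last first.
  by move=> m /memN_msupp_eq0 ->; rewrite normr0 mul0r.
rewrite -big_filter; apply: perm_big; apply: uniq_perm.
- exact: msupp_uniq.
- exact: filter_uniq.
- move=> m; rewrite mem_filter; apply/idP/andP => [mp|[]//].
  by split=> //; exact: ps.
Qed.

Section Radius.
Variable rho : K.
Hypothesis rho0 : 0 <= rho.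

Lemma mnorm_partial p (s : seq (multinom r)) : uniq s ->
  \sum_(m <- s) `|mcoeff m p| * rho ^+ mdeg m <= mnorm rho p.
Proof.
move=> us; have t_ge0 m : 0 <= `|mcoeff m p| * rho ^+ mdeg m.
  by rewrite mulr_ge0// exprn_ge0.
rewrite (mnorm_seq rho (undup_uniq (s ++ msupp p))); last first.
  by move=> m mp; rewrite mem_undup mem_cat mp orbT.
rewrite [leRHS](bigID (mem s))/=.
rewrite -[X in _ <= X + _]big_filter [X in _ <= X + _](perm_big s) /=.
  by rewrite lerDl sumr_ge0.
apply: uniq_perm; [by rewrite filter_uniq// undup_uniq|exact: us|].
by move=> m; rewrite mem_filter mem_undup mem_cat /=; case: (m \in s).
Qed.

Lemma mnorm_ge0 p : 0 <= mnorm rho p.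
Proof. by rewrite sumr_ge0// => m _; rewrite mulr_ge0// exprn_ge0. Qed.

Lemma mcoeff_le p m : `|mcoeff m p| * rho ^+ mdeg m <= mnorm rho p.
Proof. by have := mnorm_partial p (s := [:: m]) isT; rewrite big_seq1. Qed.

Lemma mnormB p q : mnorm rho (p - q) <= mnorm rho p + mnorm rho q.
Proof.
pose s := undup (msupp p ++ msupp q); have us : uniq s := undup_uniq _.
rewrite (mnorm_seq rho us); last by move=> m /msuppB_le; rewrite mem_undup.
rewrite (mnorm_seq rho (p := p) us); last first.
  by move=> m mp; rewrite mem_undup mem_cat mp.
rewrite (mnorm_seq rho (p := q) us); last first.
  by move=> m mp; rewrite mem_undup mem_cat mp orbT.
rewrite -big_split; apply: ler_sum => m _ /=.
by rewrite -mulrDl ler_wpM2r ?exprn_ge0// mcoeffB ler_normB.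
Qed.

Lemma mnorm0 : mnorm rho 0 = 0.
Proof. by rewrite /mnorm msupp0 big_nil. Qed.

Lemma mnormZX (c : K) m : mnorm rho (c *: mpolyX K m) <= `|c| * rho ^+ mdeg m.
Proof.
rewrite (mnorm_seq rho (s := [:: m]))// ?big_seq1 ?mcoeffZ ?mcoeffX ?eqxx ?mulr1//.
by move=> m' /msuppZ_le; rewrite msuppX.
Qed.

Lemma mnormM p q : mnorm rho (p * q) <= mnorm rho p * mnorm rho q.
Proof.
have ND p1 p2 : mnorm rho (p1 + p2) <= mnorm rho p1 + mnorm rho p2.
  rewrite -[p2 in leLHS]opprK (le_trans (mnormB _ _))// lerD2l.
  by have := mnormB 0 p2; rewrite sub0r mnorm0 add0r.
have Nsum (s : seq (multinom r)) (F : multinom r -> {mpoly K[r]}) :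
    mnorm rho (\sum_(m <- s) F m) <= \sum_(m <- s) mnorm rho (F m).
  elim/big_rec2: _ => [|m y1 y2 _ h]; first by rewrite mnorm0.
  by rewrite (le_trans (ND _ _))// lerD2l.
rewrite [p in leLHS]mpolyE [q in leLHS]mpolyE mulr_suml (le_trans (Nsum _ _))//.
rewrite [mnorm rho p]/mnorm mulr_suml; apply: ler_sum => m _.
rewrite mulr_sumr (le_trans (Nsum _ _))// /mnorm mulr_sumr; apply: ler_sum => m' _.
rewrite -scalerAl -scalerAr scalerA -mpolyXD (le_trans (mnormZX _ _))//.
by rewrite normrM mdegD exprD mulrACA.
Qed.

Lemma mnorm_seminorm : ring_seminorm (mnorm rho).
Proof.
split; [exact: mnorm_ge0|exact: mnorm0| |exact: mnormB|exact: mnormM].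
by rewrite /mnorm msupp1 big_seq1 mcoeff1 eqxx normr1 mdeg0 mulr1.
Qed.

Lemma mnorm_monomial (x : 'rV[K]_r) (m : multinom r) : (forall i, `|x 0 i| <= rho) ->
  `|\prod_i x 0 i ^+ m i| <= rho ^+ mdeg m.
Proof.
move=> xr; rewrite normr_prod mdegE (big_morph _ (exprD rho) (expr0 rho)).
by apply: ler_prod => i _; rewrite normr_ge0 normrX lerXn2r ?nnegrE.
Qed.

Lemma meval_le_mnorm (x : 'rV[K]_r) p : (forall i, `|x 0 i| <= rho) ->
  `|mevalK p x| <= mnorm rho p.
Proof.
move=> xr; rewrite /mevalK mevalE (le_trans (ler_norm_sum _ _ _))//.
by apply: ler_sum => m _; rewrite normrM ler_wpM2l ?mnorm_monomial.
Qed.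

Lemma mnorm_le1 p : rho <= 1 -> mnorm rho p <= mnorm 1 p.
Proof.
move=> r1; apply: ler_sum => m _; rewrite expr1n ler_wpM2l//.
by rewrite exprn_ile1.
Qed.

(** Every monomial that occurs has degree at least 1 and so yields a factor [rho]. *)
Lemma mnorm_shrink p : rho <= 1 -> mcoeff mnm0 p = 0 ->
  mnorm rho p <= rho * mnorm 1 p.
Proof.
move=> r1 p0; rewrite /mnorm mulr_sumr big_seq [leRHS]big_seq; apply: ler_sum => m mp.
rewrite mulrCA expr1n mulr1 ler_wpM2l//.
have : mdeg m != 0%N.
  by rewrite mdeg_eq0; apply: contraTneq mp => ->; rewrite mcoeff_msupp p0 eqxx.
by case: (mdeg m) => // n _; rewrite exprS ler_piMr// exprn_ile1.
Qed.

End Radius.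

End WeightedNorm.

(** * Completeness assumptions and the choice of radii *)

Section FixedPoint.
Variable K : numFieldType.

(* The factor is 4 and not 2 because for complex sequences the bounds on the real
   and imaginary parts are added. *)
Definition geometric_complete := forall (u : nat -> K) C,
  (forall n, `|u n.+1 - u n| <= C / 2 ^+ n) ->
  exists l, forall n, `|u n - l| <= C *+ 4 / 2 ^+ n.

Definition geometric_archimedean := forall C e : K, 0 <= C -> 0 < e ->
  exists n, C / 2 ^+ n < e.

Variable r : nat.
Implicit Types (Q : {poly {mpoly K[r]}}) (x : 'rV[K]_r).

Definition evalK x (p : {mpoly K[r]}) : K := mevalK p x.

Lemma evalK_is_zmod_morphism x : zmod_morphism (evalK x).
Proof. by move=> p q; rewrite /evalK /mevalK rmorphB. Qed.

Lemma evalK_is_monoid_morphism x : monoid_morphism (evalK x).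
Proof. by split=> [|p q]; rewrite /evalK /mevalK ?rmorph1 ?rmorphM. Qed.

HB.instance Definition _ x := GRing.isZmodMorphism.Build _ _ (evalK x)
  (evalK_is_zmod_morphism x).
HB.instance Definition _ x := GRing.isMonoidMorphism.Build _ _ (evalK x)
  (evalK_is_monoid_morphism x).

(** Terms of degree at least 2 are made small by [delta]; then the coefficients of degree 0 and 1,
    which vanish at the centre, are made small by [rho]. *)
Lemma lipschitz_radii Q e : 0 < e -> mcoeff mnm0 Q`_0 = 0 -> mcoeff mnm0 Q`_1 = 0 ->
  exists rho delta, [/\ 0 < rho, 0 < delta, delta <= e,
    lipschitz_const (mnorm rho) Q delta <= 2^-1 &
    mnorm rho Q`_0 <= delta / 8].
Proof.
move=> e0 Q00 Q10; pose n := size Q; have N1 p : 0 <= mnorm (1 : K) p.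
  exact: mnorm_ge0.
pose C := 1 + \sum_(i < n) mnorm 1 Q`_i * i.+1%:R.
have C1 : 1 <= C by rewrite lerDl sumr_ge0// => i _; rewrite mulr_ge0.
have C0 : 0 < C := lt_le_trans ltr01 C1.
have e1 : 0 < 1 + e by rewrite addr_gt0.
have C4 : 0 < 4 * C by rewrite mulr_gt0.
(* The factor [e / (1 + e)] lies below both [e] and 1. The other factors give [delta * C <= 1/4] and
   [rho * C <= delta / 8]. *)
pose delta := (e / (1 + e)) / (4 * C); pose rho := delta / (8 * C).
have d0 : 0 < delta by rewrite !divr_gt0.
have C8 : 0 < 8 * C by rewrite mulr_gt0.
have r0 : 0 < rho by rewrite divr_gt0.
have inv4C : (4 * C)^-1 <= 1.
  by rewrite invf_le1// (le_trans C1)// ler_peMl ?ler1n ?(ltW C0).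
have ee1 : e / (1 + e) <= 1 by rewrite ler_pdivrMr// mul1r lerDr.
have dC : delta * C <= 4^-1.
  by rewrite /delta invfM mulrA mulfVK ?gt_eqF// ler_piMl// invr_ge0.
have rd : rho <= delta.
  by rewrite ler_piMr ?(ltW d0)// invf_le1// (le_trans C1)// ler_peMl ?ler1n ?(ltW C0).
have d1 : delta <= 1.
  by rewrite /delta mulr_ile1// ?invr_ge0 ltW// divr_gt0.
have r1 : rho <= 1 := le_trans rd d1.
have de : delta <= e.
  rewrite /delta -mulrA ler_piMr ?(ltW e0)// mulr_ile1// ?invr_ge0 ?ltW//.
  by rewrite invf_lt1// ltrDl.
have rC : rho * C <= delta / 8.
  by rewrite /rho invfM mulrA mulfVK ?gt_eqF.
clearbody rho delta; have d0' := ltW d0; have r0' := ltW r0.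
exists rho, delta; split=> //.
- have : delta * C <= 2^-1.
    by rewrite (le_trans dC)// lef_pV2 ?posrE// ler_nat.
  apply: le_trans; rewrite mulrDr mulr1 mulr_sumr.
  rewrite (@le_trans _ _ (\sum_(i < n) delta * (mnorm 1 Q`_i * i.+1%:R)))//; last first.
    by rewrite lerDr ltW.
  (* The term of index 0 is 0; for index 1 the small factor is [rho <= delta], from the missing
     constant term; from index 2 on it is a power of [delta]. *)
  apply: ler_sum => -[[|[|i]] ilt] _ /=.
  + by rewrite mul0r mulr0 !mulr_ge0.
  + rewrite expr0 !mulr1 (le_trans (mnorm_shrink _ _ _))//.
    rewrite mulrA mulr_natr (@le_trans _ _ (delta * mnorm 1 Q`_1))//.
      by rewrite ler_wpM2r.
    by rewrite mulr2n lerDl mulr_ge0.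
  + rewrite (@le_trans _ _ (mnorm 1 Q`_i.+2 * (i.+3%:R * delta)))//.
      have h : 0 <= i.+2%:R * delta ^+ i.+1 by rewrite mulr_ge0// exprn_ge0.
      apply: ler_pM; [exact: mnorm_ge0|exact: h|exact: mnorm_le1|].
      apply: ler_pM; [exact: ler0n|exact: exprn_ge0|by rewrite ler_nat|].
      by rewrite exprS ler_piMr ?exprn_ile1.
    by rewrite mulrA mulrC.
- rewrite (le_trans (mnorm_shrink r0' r1 Q00))// (le_trans _ rC)// ler_wpM2l//.
  have [Q0|] := ltnP 0 n.
    rewrite /C (bigD1 (Ordinal Q0))//= mulr1 addrCA lerDl addr_ge0 ?sumr_ge0//.
    by move=> i _; rewrite mulr_ge0.
  by rewrite leqn0 size_poly_eq0 => /eqP ->; rewrite coef0 mnorm0 ltW.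
Qed.


End FixedPoint.

(** * The fixed point and its power series *)

Section AnalyticFixedPoint.
Variables (K : numFieldType) (r : nat).
Hypothesis Kcomplete : geometric_complete K.
Hypothesis Karchi : geometric_archimedean K.
Implicit Types (Q : {poly {mpoly K[r]}}) (x : 'rV[K]_r).

Lemma geometric_eq0 (C x : K) : 0 <= C -> (forall n, `|x| <= C / 2 ^+ n) -> x = 0.
Proof.
move=> C0 xC; apply/eqP; apply: contraT; rewrite -normr_gt0 => /(Karchi C0)[n].
by move=> /(le_lt_trans (xC n)); rewrite ltxx.
Qed.

Definition mnm_of_ffun (alpha : {ffun 'I_r -> nat}) : multinom r :=
  Multinom [tuple alpha i | i < r].

Definition ffun_of_mnm (m : multinom r) : {ffun 'I_r -> nat} := [ffun i => m i].

Lemma mnm_of_ffunK : cancel mnm_of_ffun ffun_of_mnm.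
Proof. by move=> alpha; apply/ffunP => i; rewrite ffunE mnmE. Qed.

Lemma ffun_of_mnmK : cancel ffun_of_mnm mnm_of_ffun.
Proof. by move=> m; apply/mnmP => i; rewrite mnmE ffunE. Qed.

Lemma monomial_atE x alpha :
  monomial_at x alpha = \prod_i x 0 i ^+ mnm_of_ffun alpha i.
Proof. by apply: eq_bigr => i _; rewrite mnmE. Qed.

Lemma evalK_seq x (p : {mpoly K[r]}) (s : seq (multinom r)) :
  uniq s -> {subset msupp p <= s} ->
  evalK x p = \sum_(m <- s) mcoeff m p * \prod_i x 0 i ^+ m i.
Proof.
move=> us ps; rewrite /evalK /mevalK mevalE.
rewrite [RHS](bigID (mem (msupp p)))/= [X in _ + X]big1 ?addr0; last first.
  by move=> m /memN_msupp_eq0 ->; rewrite mul0r.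
rewrite -[RHS]big_filter; apply: perm_big; apply: uniq_perm.
- exact: msupp_uniq.
- exact: filter_uniq.
- move=> m; rewrite mem_filter; apply/idP/andP => [mp|[]//].
  by split=> //; exact: ps.
Qed.

Lemma power_sum_cvg (C : K) (f : {ffun 'I_r -> nat} -> K) (l : K) : 0 <= C ->
  (forall n, exists s : seq (multinom r), forall s', uniq s' -> {subset s <= s'} ->
    `|\sum_(m <- s') f (ffun_of_mnm m) - l| <= C / 2 ^+ n) ->
  summability.partial_sum f @ summability.totally --> l.
Proof.
move=> C0 fC.
have FT : Filter (@summability.totally {ffun 'I_r -> nat}).
  exact: summability.totally_filter.
apply/cvgrPdist_le => e e0; have [n Ce] := Karchi C0 e0.
have [s sP] := fC n; exists [fset ffun_of_mnm m | m in s]%fset => // B /= AB.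
rewrite distrC /summability.partial_sum -(big_seq_fsetE _ _ predT) /=.
have -> : \sum_(i <- B) f i = \sum_(m <- map mnm_of_ffun B) f (ffun_of_mnm m).
  by rewrite big_map; apply: eq_bigr => i _; rewrite mnm_of_ffunK.
apply: le_trans (ltW Ce); apply: sP.
  by rewrite map_inj_uniq ?fset_uniq//; exact: can_inj mnm_of_ffunK.
move=> m ms; rewrite -[m]ffun_of_mnmK map_f//.
by apply: (fsubsetP AB); exact: in_imfset.
Qed.

Section Iteration.
Variables (Q : {poly {mpoly K[r]}}) (rho delta : K).
Hypotheses (rho_gt0 : 0 < rho) (delta_gt0 : 0 < delta).
Hypothesis lipQ : lipschitz_const (mnorm rho) Q delta <= 2^-1.
Hypothesis Q0_small : mnorm rho Q`_0 <= delta / 8.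

Let rho_ge0 := ltW rho_gt0.
Let delta_ge0 := ltW delta_gt0.
Let NN := @mnorm_seminorm K r rho rho_ge0.
(** A single Cauchy sequence of polynomials: its values at [x] converge to the fixed point over [x],
    its coefficients to those of the power series. *)
Let w n : {mpoly K[r]} := iter n (fun v => Q.[v]) 0.

Let two_gt0 n : 0 < (2 : K) ^+ n. Proof. exact: exprn_gt0. Qed.

Let wS n : w n.+1 = Q.[w n]. Proof. by []. Qed.

Let lip u v : mnorm rho u <= delta -> mnorm rho v <= delta ->
  mnorm rho (Q.[u] - Q.[v]) <= 2^-1 * mnorm rho (u - v).
Proof.
move=> ud vd; rewrite (le_trans (horner_lipschitz NN _ ud vd))//.
by rewrite ler_wpM2r// mnorm_ge0.
Qed.

Let half_le : delta / 2 <= delta.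
Proof. by rewrite ler_pdivrMr// ler_peMr// ler1n. Qed.

(** The contraction halves the norm of [w n], and the displacement of 0 adds at most [delta / 8]. *)
Let w_le n : mnorm rho (w n) <= delta / 2.
Proof.
elim: n => [|n IH]; first by rewrite mnorm0 divr_ge0.
rewrite wS -[Q.[w n]](subrK Q.[0]) (le_trans (seminormD NN _ _))//.
have -> : delta / 2 = 2^-1 * (delta / 2) + delta / 4 by field.
rewrite lerD//; last first.
  by rewrite horner_coef0 (le_trans Q0_small)// ler_wpM2l// lef_pV2 ?posrE// ler_nat.
rewrite (le_trans (lip _ _))// ?mnorm0// ?(le_trans IH)//.
by rewrite subr0 ler_wpM2l.
Qed.

Let w_le' n : mnorm rho (w n) <= delta := le_trans (w_le n) half_le.

Let w_step n : mnorm rho (w n.+1 - w n) <= delta / 8 / 2 ^+ n.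
Proof.
elim: n => [|n IH]; first by rewrite wS subr0 horner_coef0 divr1.
apply: le_trans (lip (w_le' n.+1) (w_le' n)) _.
by rewrite exprS invfM mulrCA ler_wpM2l.
Qed.

Let w_cauchy n k : mnorm rho (w (n + k) - w n) <= delta / 2 / 2 ^+ n.
Proof.
(* With the remaining geometric tail subtracted, the bound passes through the induction on [k]. *)
suff : mnorm rho (w (n + k) - w n) <=
    delta / 4 / 2 ^+ n - delta / 4 / 2 ^+ (n + k).
  move=> /le_trans; apply; apply: (@le_trans _ _ (delta / 4 / 2 ^+ n)).
    by rewrite gerBl !divr_ge0// exprn_ge0.
  rewrite ler_wpM2r ?invr_ge0 ?exprn_ge0//.
  by rewrite ler_wpM2l// lef_pV2 ?posrE// ler_nat.
elim: k => [|k IH]; first by rewrite addn0 !subrr mnorm0.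
rewrite -[w (n + k.+1) - w n](subrKA (w (n + k))) (le_trans (seminormD NN _ _))//.
rewrite addnS (le_trans (lerD (w_step _) IH))// exprS.
have k0 : (2 : K) ^+ (n + k) != 0 by rewrite gt_eqF.
have n0 : (2 : K) ^+ n != 0 by rewrite gt_eqF.
move: (2 ^+ (n + k)) (2 ^+ n) k0 n0 => u v u0 v0.
rewrite le_eqVlt; apply/orP; left; apply/eqP.
by field; rewrite u0 v0.
Qed.

Lemma analytic_fixed_point_aux : exists phi c,
  forall x, (forall i, `|x 0 i| <= rho) ->
  [/\ `|phi x| < delta,
      (map_poly (evalK x) Q).[phi x] = phi x,
      (forall v, `|v| <= delta -> (map_poly (evalK x) Q).[v] = v -> v = phi x),
      (forall v, `|v| <= delta -> `|(map_poly (evalK x) Q)^`().[v]| <= 2^-1) &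
      summability.partial_sum (fun alpha => c alpha * monomial_at x alpha)
        @ summability.totally --> phi x].
Proof.
have dle n : delta / 8 *+ 4 / 2 ^+ n = delta / 2 / 2 ^+ n.
  by congr (_ / _); field.
have /boolp.choice[phi phiP] x : exists l, (forall i, `|x 0 i| <= rho) ->
    forall n, `|evalK x (w n) - l| <= delta / 2 / 2 ^+ n.
  have [xr|xr] := pselect (forall i, `|x 0 i| <= rho); last by exists 0.
  have [|l lP] := Kcomplete (u := fun n => evalK x (w n)) (C := delta / 8).
    move=> n; apply: le_trans (w_step n); rewrite -rmorphB.
    exact: meval_le_mnorm.
  by exists l => _ n; rewrite -dle.
have /boolp.choice[c cP] (m : multinom r) : exists l, forall n,
    `|mcoeff m (w n) - l| * rho ^+ mdeg m <= delta / 2 / 2 ^+ n.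
  have rm : 0 < rho ^+ mdeg m by exact: exprn_gt0.
  have [|l lP] := Kcomplete (u := fun n => mcoeff m (w n))
    (C := delta / 8 / rho ^+ mdeg m).
    move=> n; rewrite -mcoeffB mulrAC ler_pdivlMr//.
    exact: le_trans (mcoeff_le rho_ge0 _ _) (w_step n).
  exists l => n; rewrite -dle -ler_pdivlMr// (le_trans (lP n))//.
  by rewrite -!mulrnAl [leRHS]mulrAC.
exists phi, (c \o mnm_of_ffun) => x xr; have phin := phiP _ xr.
pose Qx := map_poly (evalK x) Q.
have lipx u v : `|u| <= delta -> `|v| <= delta ->
    `|Qx.[u] - Qx.[v]| <= 2^-1 * `|u - v|.
  move=> ud vd; rewrite (le_trans (horner_lipschitz (norm_ring_seminorm K) _ ud vd))//.
  rewrite ler_wpM2r// (le_trans _ lipQ)//.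
  by apply: lipschitz_const_le => // [|p]; [exact: normr0|exact: meval_le_mnorm].
have half1 : delta / 2 < delta by rewrite ltr_pdivrMr// ltr_pMr// ltr1n.
(* Since [w 0 = 0], the estimate at [n = 0] bounds [phi x] by [delta / 2]. *)
have phi_lt : `|phi x| < delta.
  by have := phin 0; rewrite rmorph0 sub0r normrN divr1 => /le_lt_trans; apply.
have phi_fix : Qx.[phi x] = phi x.
  apply/eqP; rewrite -subr_eq0; apply/eqP; apply: (geometric_eq0 delta_ge0) => n.
  (* The intermediate point is the value at [x] of [w n.+1]: near [Qx.[phi x]] by contraction and
     near [phi x] by convergence. *)
  rewrite -(subrKA Qx.[evalK x (w n)]) (le_trans (ler_normD _ _))//.
  have -> : delta / 2 ^+ n = 2^-1 * (delta / 2 / 2 ^+ n) +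
      (delta / 2 / 2 ^+ n.+1 + delta / 2 / 2 ^+ n).
    rewrite exprS; have : (2 : K) ^+ n != 0 by rewrite gt_eqF.
    by move: (2 ^+ n) => u u0; field.
  rewrite lerD//.
    rewrite (le_trans (lipx _ _ _ _)) ?(ltW phi_lt)//.
      by rewrite (le_trans (meval_le_mnorm rho_ge0 _ xr)).
    by rewrite ler_wpM2l// distrC.
  rewrite [Qx.[evalK x (w n)]]horner_map -wS (le_trans (phin _))//.
  by rewrite lerDl !divr_ge0// exprn_ge0.
split=> //.
- move=> v vd vfix; apply/eqP; rewrite -subr_eq0 -normr_le0.
  have := lipx _ _ vd (ltW phi_lt); rewrite vfix phi_fix.
  rewrite -subr_le0 -[X in X - _]mul1r -mulrBl.
  have -> : 1 - 2^-1 = 2^-1 :> K by field.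
  by rewrite pmulr_rle0.
- move=> v vd; rewrite (le_trans (deriv_bound (norm_ring_seminorm K) _ vd))//.
  rewrite (le_trans _ lipQ)//.
  by apply: lipschitz_const_le => // [|p]; [exact: normr0|exact: meval_le_mnorm].
apply: (@power_sum_cvg (delta *+ 2)) => [|n]; first by rewrite mulrn_wge0.
(* Over any [s] containing its support, [w n] evaluates exactly; the partial sum is compared with
   that value, and the value with [phi x]. *)
exists (msupp (w n)) => s us ws; rewrite -(subrKA (evalK x (w n))).
have dn : 0 <= delta / 2 / 2 ^+ n by rewrite !divr_ge0// exprn_ge0.
have -> : delta *+ 2 / 2 ^+ n = (delta / 2 / 2 ^+ n + delta / 2 / 2 ^+ n)
   + delta / 2 / 2 ^+ n + delta / 2 / 2 ^+ n.
  have : (2 : K) ^+ n != 0 by rewrite gt_eqF.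
  by move: (2 ^+ n) => u u0; field.
rewrite (le_trans (ler_normD _ _))// -addrA lerD//; last first.
  by rewrite (le_trans (phin n))// lerDl.
rewrite (evalK_seq x us ws) -sumrB (le_trans (ler_norm_sum _ _ _))//.
(* [w M] is close enough to the limit since [size s <= 2 ^ size s]. *)
pose M := (n + size s)%N.
rewrite (@le_trans _ _ (\sum_(m <- s) (`|c m - mcoeff m (w M)| * rho ^+ mdeg m +
    `|mcoeff m (w M - w n)| * rho ^+ mdeg m)))//.
  apply: ler_sum => m _; rewrite /= monomial_atE ffun_of_mnmK -mulrBl normrM -mulrDl.
  apply: ler_pM => //; last exact: mnorm_monomial.
  by rewrite mcoeffB -[in leLHS](subrKA (mcoeff m (w M)) (c m)) ler_normD.
rewrite big_split /= lerD//; last first.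
  exact: le_trans (mnorm_partial rho_ge0 _ us) (w_cauchy n (size s)).
rewrite (@le_trans _ _ (\sum_(m <- s) delta / 2 / 2 ^+ M))//.
  by apply: ler_sum => m _; rewrite distrC.
rewrite big_const_seq count_predT iter_addr_0 /M exprD invfM mulrA -mulrnAr ler_piMr//.
by rewrite -mulr_natl ler_pdivrMr// mul1r -natrX ler_nat ltnW// ltn_expl.
Qed.

End Iteration.

Theorem analytic_fixed_point Q e :
  0 < e -> mcoeff mnm0 Q`_0 = 0 -> mcoeff mnm0 Q`_1 = 0 ->
  exists rho delta phi c, [/\ 0 < rho, 0 < delta, delta <= e &
  forall x, (forall i, `|x 0 i| <= rho) ->
  [/\ `|phi x| < delta,
      (map_poly (evalK x) Q).[phi x] = phi x,
      (forall v, `|v| <= delta -> (map_poly (evalK x) Q).[v] = v -> v = phi x),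
      (forall v, `|v| <= delta -> `|(map_poly (evalK x) Q)^`().[v]| <= 2^-1) &
      summability.partial_sum (fun alpha => c alpha * monomial_at x alpha)
        @ summability.totally --> phi x]].
Proof.
move=> e0 Q00 Q10; have [rho [delta [r0 d0 de lipQ Q0]]] := lipschitz_radii e0 Q00 Q10.
have [phi [c phiP]] := analytic_fixed_point_aux r0 d0 lipQ Q0.
by exists rho, delta, phi, c.
Qed.

End AnalyticFixedPoint.

(** * From the fixed point to the implicit function *)

Section ImplicitFunction.
Variables (K : numFieldType) (r : nat).
Hypothesis Kcomplete : geometric_complete K.
Hypothesis Karchi : geometric_archimedean K.
Implicit Types (P : {poly {mpoly K[r]}}) (a s x : 'rV[K]_r) (b v : K).

Definition shift_mpoly a (p : {mpoly K[r]}) : {mpoly K[r]} :=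
  comp_mpoly [tuple mpolyX K (mnm1 i) + mpolyC r (a 0 i) | i < r] p.

Lemma shift_mpoly_is_zmod_morphism a : zmod_morphism (shift_mpoly a).
Proof. by move=> p q; exact: comp_mpolyB. Qed.

Lemma shift_mpoly_is_monoid_morphism a : monoid_morphism (shift_mpoly a).
Proof.
by have [M1 M2] := comp_mpoly_is_multiplicative
  [tuple mpolyX K (mnm1 i) + mpolyC r (a 0 i) | i < r].
Qed.

HB.instance Definition _ a := GRing.isZmodMorphism.Build _ _ (shift_mpoly a)
  (shift_mpoly_is_zmod_morphism a).
HB.instance Definition _ a := GRing.isMonoidMorphism.Build _ _ (shift_mpoly a)
  (shift_mpoly_is_monoid_morphism a).

Lemma evalK_shift a x p : evalK x (shift_mpoly a p) = evalK (x + a) p.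
Proof.
rewrite /evalK /mevalK comp_mpoly_meval; apply: meval_eq => i.
by rewrite tnth_mktuple mevalD mevalXU mevalC !mxE.
Qed.

Lemma mcoeff0_evalK (p : {mpoly K[r]}) : mcoeff mnm0 p = evalK 0 p.
Proof.
rewrite [p]mpolyE rmorph_sum raddf_sum; apply: eq_bigr => m _ /=.
rewrite mcoeffZ mcoeffX /evalK /mevalK mevalZ mevalX; congr (_ * _).
have [->|m0] := eqVneq m mnm0.
  by rewrite big1// => i _; rewrite mxE mnmE expr0.
have [i mi] : exists i, m i != 0%N.
  apply/existsP; apply: contraT; rewrite negb_exists => /forallP mi.
  case/eqP: m0; apply/mnmP => i; rewrite mnmE.
  by apply/eqP; have := mi i; rewrite negbK.
by rewrite (bigD1 i)//= mxE expr0n (negbTE mi) mul0r.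
Qed.

(* Its fixed points over x are the w such that P vanishes at (x + a, w + b). *)
Definition newton_poly P a b (c : K) : {poly {mpoly K[r]}} :=
  'X - (mpolyC r c^-1) *: (map_poly (shift_mpoly a) P \Po ('X + (mpolyC r b)%:P)).

Lemma map_newton_poly P a b c x : map_poly (evalK x) (newton_poly P a b c) =
  'X - c^-1 *: (map_poly (evalK (x + a)) P \Po ('X + b%:P)).
Proof.
have evalKC u : evalK x (mpolyC r u) = u by rewrite /evalK /mevalK mevalC.
rewrite rmorphB /= map_polyX map_polyZ map_comp_poly rmorphD /= map_polyX map_polyC /=.
rewrite !evalKC -map_poly_comp; congr (_ - _ *: (_ \Po _)).
by apply: eq_map_poly => p /=; exact: evalK_shift.
Qed.

Lemma horner_newton_poly P a b c x v :
  (map_poly (evalK x) (newton_poly P a b c)).[v] =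
  v - c^-1 * (map_poly (evalK (x + a)) P).[v + b].
Proof.
rewrite map_newton_poly hornerD hornerN hornerZ hornerX.
by rewrite horner_comp hornerD hornerX hornerC.
Qed.

Lemma deriv_newton_poly P a b c x v :
  (map_poly (evalK x) (newton_poly P a b c))^`().[v] =
  1 - c^-1 * (map_poly (evalK (x + a)) P)^`().[v + b].
Proof.
rewrite map_newton_poly derivB derivX derivZ deriv_comp derivD derivX derivC addr0 mulr1.
by rewrite hornerD hornerN hornerZ hornerC horner_comp hornerD hornerX hornerC.
Qed.

(** The Newton map and its derivative in [v] vanish at the centre, as the fixed-point theorem
    requires. The simple root at [phi s] permits a new application there, and the bound [e] keeps
    the new root in the old uniqueness region. *)
Theorem implicit_function P a b e : 0 < e ->
  (map_poly (evalK a) P).[b] = 0 -> (map_poly (evalK a) P)^`().[b] != 0 ->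
  exists rho delta phi c, [/\ 0 < rho, 0 < delta, delta <= e &
  forall s, (forall i, `|s 0 i - a 0 i| <= rho) ->
  [/\ `|phi s - b| < delta,
      (map_poly (evalK s) P).[phi s] = 0,
      (forall v, `|v - b| <= delta -> (map_poly (evalK s) P).[v] = 0 -> v = phi s),
      (map_poly (evalK s) P)^`().[phi s] != 0 &
      summability.partial_sum (fun alpha => c alpha * monomial_at (s - a) alpha)
        @ summability.totally --> phi s]].
Proof.
move=> e0 Pab dPab; set c0 := (map_poly (evalK a) P)^`().[b] in dPab.
pose Q := newton_poly P a b c0.
have Q00 : mcoeff mnm0 Q`_0 = 0.
  rewrite mcoeff0_evalK -coef_map -horner_coef0 horner_newton_poly !add0r Pab.
  by rewrite mulr0 oppr0.
have Q10 : mcoeff mnm0 Q`_1 = 0.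
  rewrite mcoeff0_evalK -coef_map -[LHS]mulr1n -(coef_deriv _ 0) -horner_coef0.
  by rewrite deriv_newton_poly !add0r -/c0 mulVf// subrr.
have [rho [delta [phi [c [r0 d0 de phiP]]]]] :=
  analytic_fixed_point Kcomplete Karchi e0 Q00 Q10.
(* The power series of the constant [b], added because the fixed point is measured from [b]. *)
pose g (alpha : {ffun 'I_r -> nat}) : K := if mnm_of_ffun alpha == mnm0 then b else 0.
exists rho, delta, (fun s => phi (s - a) + b), (c \+ g); split=> // s sa.
have [|phid phifix phiuniq phideriv phisum] := phiP (s - a).
  by move=> i; rewrite !mxE.
have cancel_c v : c0^-1 * (map_poly (evalK s) P).[v + b] = 0 <->
    (map_poly (evalK s) P).[v + b] = 0.
  split=> [/eqP|->]; last by rewrite mulr0.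
  by rewrite mulf_eq0 invr_eq0 (negbTE dPab) => /eqP.
split.
- by rewrite addrK.
- apply/cancel_c; move: phifix; rewrite horner_newton_poly subrK => /eqP.
  by rewrite -subr_eq0 addrAC subrr add0r oppr_eq0 => /eqP.
- move=> v vd Pv; rewrite -(phiuniq (v - b))// ?subrK//.
  by rewrite horner_newton_poly !subrK Pv mulr0 subr0.
(* A multiple root would give the Newton map the derivative 1, against the bound 1/2. *)
- apply: contraTneq (phideriv _ (ltW phid)).
  rewrite deriv_newton_poly subrK => ->; rewrite mulr0 subr0 normr1.
  by rewrite lt_geF// invf_lt1// ltr1n.
have FT : Filter (@summability.totally {ffun 'I_r -> nat}).
  exact: summability.totally_filter.
have -> : summability.partial_sum
      (fun alpha => (c \+ g) alpha * monomial_at (s - a) alpha) =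
    summability.partial_sum (fun alpha => c alpha * monomial_at (s - a) alpha) \+
    summability.partial_sum (fun alpha => g alpha * monomial_at (s - a) alpha).
  apply: boolp.funext => A; rewrite /summability.partial_sum/= -big_split/=.
  by apply: eq_bigr => i _; rewrite mulrDl.
apply: cvgD => //; apply: (power_sum_cvg Karchi (lexx 0)) => n.
exists [:: mnm0] => t ut mt; rewrite (bigD1_seq mnm0) ?mt ?mem_head//=.
rewrite big1 => [|m m0]; rewrite /g ffun_of_mnmK.
  rewrite eqxx addr0 /monomial_at big1 ?mulr1 ?subrr ?normr0 ?mul0r// => i _.
  by rewrite ffunE mnmE expr0.
by rewrite (negbTE m0) mul0r.
Qed.

(* Near any point of U, the germ of phi is recovered by applying
   implicit_function again at that point, by local uniqueness. *)
Corollary implicit_analytic P a b :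
  (map_poly (evalK a) P).[b] = 0 -> (map_poly (evalK a) P)^`().[b] != 0 ->
  exists rho phi, [/\ 0 < rho, phi a = b,
    (forall s, ball a rho s -> (map_poly (evalK s) P).[phi s] = 0) &
    forall U, open U -> U `<=` ball a rho -> analytic_on U phi].
Proof.
move=> Pab dPab.
have [rho [delta [phi [c [r0 d0 _ phiP]]]]] := implicit_function ltr01 Pab dPab.
have inball s : ball a rho s -> forall i, `|s 0 i - a 0 i| <= rho.
  by move=> [_ sa] i; have := sa 0 i; rewrite /ball /= distrC => /ltW.
exists rho, phi; split=> //.
- have [|_ _ uniq _ _] := phiP a; first by move=> i; rewrite subrr normr0 ltW.
  by apply/esym/uniq => //; rewrite subrr normr0 ltW.
- by move=> s /inball /phiP[].
move=> U Uo Ua a' Ua'; have [phid Pa' _ dPa' _] := phiP a' (inball _ (Ua _ Ua')).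
(* The distance left around [phi a'] within the uniqueness region of the first application. *)
have e0 : 0 < delta - `|phi a' - b| by rewrite subr_gt0.
have [rho' [delta' [phi' [c' [r0' d0' de' phiP']]]]] :=
  implicit_function e0 Pa' dPa'.
exists c'; near=> s.
have sa' i : `|s 0 i - a' 0 i| <= rho'.
  have [_ /(_ 0 i)] : ball a' rho' s by near: s; exact: nbhsx_ballx.
  by rewrite /ball /= distrC => /ltW.
have Us : U s by near: s; exact: open_nbhs_nbhs.
have [phid' Ps _ _ sum'] := phiP' s sa'.
have [_ _ uniq _ _] := phiP s (inball _ (Ua _ Us)).
suff <- : phi' s = phi s by [].
apply: uniq => //; rewrite -(subrKA (phi a')) (le_trans (ler_normD _ _))//.
by rewrite -lerBrDr (le_trans (ltW phid')).
Unshelve. all: by end_near.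
Qed.

End ImplicitFunction.

(** * Completeness and connectedness for R and C *)

Section RealField.
Variable R : realType.

(** Nested intervals: the tail from [n] on is at most [2C / 2^n], so [u n] minus and plus this bound
    are monotone, and the supremum of the lower ends is the limit. *)
Lemma real_geometric_limit (u : nat -> R) C :
  (forall n, `|u n.+1 - u n| <= C / 2 ^+ n) ->
  exists l, forall n, `|u n - l| <= C *+ 2 / 2 ^+ n.
Proof.
move=> uC; have C0 : 0 <= C.
  by have := le_trans (normr_ge0 _) (uC 0); rewrite divr1.
have C2 n : 0 <= C *+ 2 / 2 ^+ n by rewrite divr_ge0 ?mulrn_wge0// exprn_ge0.
pose v n := u n - C *+ 2 / 2 ^+ n; pose t n := u n + C *+ 2 / 2 ^+ n.
have half n : C *+ 2 / 2 ^+ n.+1 = C / 2 ^+ n.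
  by rewrite exprS invfM mulrA -mulr_natr mulfK.
have dbl n : C *+ 2 / 2 ^+ n = C / 2 ^+ n + C / 2 ^+ n by rewrite mulr2n mulrDl.
have vS n : v n <= v n.+1.
  rewrite /v half dbl; have := uC n; rewrite ler_norml => /andP[h _].
  by rewrite -subr_ge0; move: h; rewrite -subr_ge0; congr (0 <= _); ring.
have tS n : t n.+1 <= t n.
  rewrite /t half dbl; have := uC n; rewrite ler_norml => /andP[_ h].
  by rewrite -subr_ge0; move: h; rewrite -subr_ge0; congr (0 <= _); ring.
have vm : {homo v : m n / (m <= n)%N >-> m <= n}.
  by apply: homo_leq => //; exact: le_trans.
have tm : {homo t : m n / (m <= n)%N >-> n <= m}.
  by apply: homo_leq => // x y z xy yz; exact: le_trans yz xy.
have vt m n : v m <= t n.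
  rewrite (le_trans (vm _ (maxn m n) _)) ?leq_maxl//.
  rewrite (le_trans _ (tm n (maxn m n) _)) ?leq_maxr// /v /t.
  by rewrite lerD2l (le_trans _ (C2 _))// oppr_le0.
have vne : range v !=set0 by exists (v 0); exists 0.
have vub m : ubound (range v) (t m) by move=> _ [n _ <-].
have vsup : has_sup (range v) by split=> //; exists (t 0).
exists (sup (range v)) => n.
rewrite ler_norml lerBlDr lerBrDl; apply/andP; split.
  by rewrite lerBlDr; exact: ge_sup (vub n).
rewrite -lerBlDl; apply: ub_le_sup; last by exists n.
by exists (t 0).
Qed.

Lemma real_geometric_complete : geometric_complete R.
Proof.
move=> u C uC; have [l lP] := real_geometric_limit uC; exists l => n.
rewrite (le_trans (lP n))// ler_wpM2r ?invr_ge0 ?exprn_ge0// ler_wpMn2l//.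
by have := le_trans (normr_ge0 _) (uC 0); rewrite divr1.
Qed.

Lemma real_geometric_archimedean : geometric_archimedean R.
Proof.
move=> C e C0 e0; pose n := Num.bound (C / e); exists n.
rewrite ltr_pdivrMr ?exprn_gt0// mulrC -ltr_pdivrMr//.
have /lt_le_trans : C / e < n%:R by apply: archi_boundP; rewrite divr_ge0// ltW.
by apply; rewrite -natrX ler_nat ltnW// ltn_expl.
Qed.

Lemma complex_geometric_archimedean : geometric_archimedean R[i].
Proof.
move=> C e C0 e0; move: (C0) (e0).
rewrite -(RRe_real (ger0_real C0)) -(RRe_real (gtr0_real e0)) ler0c ltcR => C0' e0'.
have [n nP] := real_geometric_archimedean C0' e0'; exists n.
by move: nP; rewrite -ltcR rmorphM fmorphV rmorphXn rmorph_nat.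
Qed.

Lemma complex_geometric_complete : geometric_complete R[i].
Proof.
move=> u C uC; have C0 : 0 <= C.
  by have := le_trans (normr_ge0 _) (uC 0); rewrite divr1.
pose c := complex.Re C; have Cc : C = c%:C%C by rewrite RRe_real// ger0_real.
have Cn n : C / 2 ^+ n = (c / 2 ^+ n)%:C%C.
  by rewrite Cc rmorphM fmorphV rmorphXn rmorph_nat.
have normc_ge_Im (z : R[i]) : `|complex.Im z|%:C%C <= `|z|.
  by rewrite normc_def lecR -sqrtr_sqr ler_wsqrtr// lerDr sqr_ge0.
have normc_le (z : R[i]) : `|z| <= (`|complex.Re z| + `|complex.Im z|)%:C%C.
  rewrite normc_def lecR.
  rewrite -[leRHS]ger0_norm ?addr_ge0// -sqrtr_sqr ler_wsqrtr// sqrrD.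
  rewrite !real_normK ?num_real//.
  by rewrite addrAC lerDl mulrn_wge0// mulr_ge0.
have [|a aP] := @real_geometric_limit (fun n => complex.Re (u n)) c.
  move=> n; rewrite -lecR -Cn (le_trans _ (uC n))//.
  by rewrite -raddfB; exact: normc_ge_Re.
have [|b bP] := @real_geometric_limit (fun n => complex.Im (u n)) c.
  move=> n; rewrite -lecR -Cn (le_trans _ (uC n))//.
  by rewrite -raddfB; exact: normc_ge_Im.
exists (a +i* b)%C => n; rewrite (le_trans (normc_le _))//.
have -> : C *+ 4 / 2 ^+ n = (c *+ 2 / 2 ^+ n + c *+ 2 / 2 ^+ n)%:C%C.
  by rewrite !mulrnAl -mulrnDr rmorphMn /= -Cn.
rewrite lecR lerD//.
  by have := aP n; rewrite raddfB.
by have := bP n; rewrite raddfB.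
Qed.

End RealField.

(** * Connectedness of balls *)

Section ConnectedBalls.
Variables (R : realType) (K : numFieldType) (f : R -> K).
Hypotheses (f_cont : continuous f) (f0 : f 0 = 0) (f1 : f 1 = 1).
Hypothesis f_le1 : forall l, 0 <= l <= 1 -> `|f l| <= 1.

(** The ball is a union of segments through its centre, images of [[0, 1]]; the map [f] stands for
    the inclusion of the reals in [K]. *)
Lemma ball_connected r (a : 'rV[K]_r) rho : connected (ball a rho).
Proof.
pose seg (s : 'rV[K]_r) (l : R) := f l *: (s - a) + a.
have seg_ball s l : ball a rho s -> 0 <= l <= 1 -> ball a rho (seg s l).
  move=> [rho0 sP] l01; split=> // i j; rewrite /seg !mxE.
  have := sP i j; rewrite /ball/= => /(le_lt_trans _); apply.
  by rewrite distrC addrK normrM -(distrC (s i j)) ler_piMl// f_le1.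
have -> : ball a rho = \bigcup_(s in ball a rho) (seg s @` `[0, 1]).
  apply/seteqP; split=> [s sa|x [s sa [l]]].
    exists s => //; exists 1; first by rewrite /= in_itv /= ler01 lexx.
    by rewrite /seg f1 scale1r subrK.
  by rewrite /= in_itv /= => l01 <-; exact: seg_ball.
apply: bigcup_connected.
  exists a => s _; exists 0; first by rewrite /= in_itv /= ler01 lexx.
  by rewrite /seg f0 scale0r add0r.
move=> s _; apply: connected_continuous_connected; first exact: segment_connected.
apply: continuous_subspaceT => l; apply: cvgD; last exact: cvg_cst.
by apply: cvgZ; [exact: f_cont|exact: cvg_cst].
Qed.

End ConnectedBalls.

Lemma real_ball_connected (R : realType) r (a : 'rV[R]_r) rho : connected (ball a rho).
Proof.
apply: (@ball_connected R R idfun) => //; last first.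
  by move=> l /andP[l0 l1]; rewrite ger0_norm.
by move=> x; exact: cvg_id.
Qed.

Lemma normc_real (R : rcfType) (x : R) : `|x%:C%C| = `|x|%:C%C.
Proof. by rewrite normc_def /= expr0n addr0 sqrtr_sqr. Qed.

Lemma real_complex_continuous (R : realType) : 
  continuous (real_complex R : R -> (R[i] : numFieldType)).
Proof.
move=> x; apply/cvgrPdist_lt => e e0; move: (e0).
rewrite -(RRe_real (gtr0_real e0)) ltcR => e0'.
have : \forall y \near (x : R), `|x - y| < complex.Re e.
  by have /cvgrPdist_lt := @cvg_id _ (nbhs (x : R)); apply.
by apply: filterS => y; rewrite -rmorphB /= normc_real ltcR.
Qed.

Lemma complex_ball_connected (R : realType) r (a : 'rV[(R[i] : numFieldType)]_r) rho :
  connected (ball a rho).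
Proof.
apply: (@ball_connected R R[i] (real_complex R)) => //.
  exact: real_complex_continuous.
by move=> l /andP[l0 l1]; rewrite normc_real lecR ger0_norm.
Qed.

(** * The parametrization *)

Section Parametrization.
Variable K : numFieldType.

Lemma evalK_map_ratr r (s : 'rV[K]_r) (P : {poly {mpoly rat[r]}}) :
  map_poly (evalK s) (map_poly (map_mpoly ratr) P) = map_poly (evalQ s) P.
Proof. by rewrite -map_poly_comp. Qed.

(** The increment of [p] from [a] has no constant term, so on a polydisc of radius [rho] it is at
    most [rho * B], which is less than the norm [A] of [p] at [a]. *)
Lemma evalK_neq0_ball r (a : 'rV[K]_r) (p : {mpoly K[r]}) : evalK a p != 0 ->
  exists2 rho, 0 < rho & forall s, ball a rho s -> evalK s p != 0.
Proof.
move=> pa; pose q := shift_mpoly a p - mpolyC r (evalK a p).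
have q0 : mcoeff mnm0 q = 0.
  rewrite mcoeff0_evalK rmorphB /= evalK_shift add0r.
  by rewrite [evalK 0 (mpolyC _ _)]/evalK /mevalK mevalC subrr.
have A0 : 0 < `|evalK a p| by rewrite normr_gt0.
set A := `|evalK a p| in A0; pose B := mnorm 1 q.
have B0 : 0 <= B by exact: mnorm_ge0.
have AB : 0 < 1 + (A + B) by rewrite addr_gt0// ltr_wpDr.
pose rho := A / (1 + (A + B)).
have rho0 : 0 < rho by rewrite divr_gt0.
have rho1 : rho <= 1.
  by rewrite ler_pdivrMr// mul1r [leRHS]addrCA lerDl addr_ge0.
have rhoB : rho * B < A.
  by rewrite /rho -mulrA gtr_pMr// mulrC ltr_pdivrMr// mul1r addrA ltrDr addr_gt0.
exists rho => // s [_ sa]; apply/eqP => ps.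
have sa' i : `|(s - a) 0 i| <= rho.
  by have := sa 0 i; rewrite /ball /= distrC !mxE => /ltW.
have := meval_le_mnorm (ltW rho0) q sa'.
rewrite -/(evalK _ _) rmorphB /= evalK_shift subrK ps add0r normrN.
rewrite [evalK _ (mpolyC _ _)]/evalK /mevalK mevalC -/A.
move=> /le_trans/(_ (mnorm_shrink (ltW rho0) rho1 q0)) /le_lt_trans/(_ rhoB).
by rewrite ltxx.
Qed.

(** Expressions of this shape are stable under sums and products. As [A] and [N] do not depend on
    the point, a relation at [t] becomes a condition on [A] that can be moved to [s]. *)
Lemma clear_denominators r m (e : {mpoly rat[r]}) (G : 'I_m -> {poly {mpoly rat[r]}})
    (f : {mpoly rat[m]}) :
  exists A N, forall (s : 'rV[K]_r) w, evalQ s e != 0 ->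
    evalQ (\row_j ((map_poly (evalQ s) (G j)).[w] / evalQ s e)) f =
    (map_poly (evalQ s) A).[w] / evalQ s e ^+ N.
Proof.
pose v (s : 'rV[K]_r) w := \row_j ((map_poly (evalQ s) (G j)).[w] / evalQ s e).
pose clearable (g : {mpoly rat[m]}) := exists A N, forall (s : 'rV[K]_r) w,
  evalQ s e != 0 -> evalQ (v s w) g = (map_poly (evalQ s) A).[w] / evalQ s e ^+ N.
have clearC c : clearable (mpolyC m c).
  exists (mpolyC r c)%:P, 0%N => s w _.
  by rewrite evalQC map_polyC hornerC /= evalQC divr1.
have clearX i : clearable (mpolyX rat (mnm1 i)).
  by exists (G i), 1%N => s w _; rewrite evalQX mxE.
have clearD g h : clearable g -> clearable h -> clearable (g + h).
  move=> [A [N gA]] [B [M hB]]; exists (e ^+ M *: A + e ^+ N *: B), (N + M)%N => s w es.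
  rewrite rmorphD /= gA// hB// rmorphD /= !map_polyZ hornerD !hornerZ /= !rmorphXn /=.
  by rewrite addf_div ?expf_neq0// exprD ![_ * (map_poly _ _).[_]]mulrC.
have clearM g h : clearable g -> clearable h -> clearable (g * h).
  move=> [A [N gA]] [B [M hB]]; exists (A * B), (N + M)%N => s w es.
  by rewrite rmorphM /= gA// hB// rmorphM hornerM exprD mulf_div.
rewrite -/(clearable f) [f]mpolyE; apply: big_ind => //.
  by rewrite -[0]mpolyC0.
move=> mm _; rewrite -mul_mpolyC; apply: (clearM _ _ (clearC _)).
rewrite mpolyXE_id; apply: big_ind => //; first by rewrite -[1]mpolyC1.
move=> i _; elim: (mm i) => [|n IH]; first by rewrite expr0 -[1]mpolyC1.
by rewrite exprS; exact: clearM.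
Qed.

End Parametrization.

(** * Consequences of minimality *)

Section SimpleRoot.
Variables (K : numFieldType) (r : nat) (t : 'rV[K]_r).
Hypothesis t_free : alg_independent t.
Local Notation iota := (frac_emb t_free).

Lemma frac_emb_over_denom e P : e != 0 -> map_poly iota (over_denom e P) =
  (evalQ t e)^-1 *: map_poly (evalQ t) P.
Proof.
move=> e0; rewrite /over_denom map_polyZ fmorphV /= frac_emb_qfrac -map_poly_comp.
congr (_ *: _); apply: eq_map_poly => p /=; exact: frac_emb_qfrac.
Qed.

(** A double root would annihilate [M'], of smaller degree, so [M' = 0]; but its top coefficient is
    the degree of [M], nonzero in characteristic 0. *)
Lemma minimal_simple_root z M : minimal_over t_free z M ->
  (map_poly iota M)^`().[z] != 0.
Proof.
move=> [Mm Mz Mmin]; apply/negP => /eqP; rewrite deriv_map => dMz.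
have M0 := monic_neq0 Mm.
have dM0 : M^`() = 0.
  apply/eqP; apply: contraT => dM0.
  have := Mmin _ dM0; rewrite rootE dMz eqxx => /(_ isT).
  by rewrite leqNgt lt_size_deriv.
have sM : (1 < size M)%N.
  rewrite ltnNge; apply/negP => /size1_polyC ME; move: Mz Mm.
  rewrite ME map_polyC rootC fmorph_eq0 => /eqP ->.
  by rewrite monicE lead_coef0 eq_sym oner_eq0.
have : M^`()`_(size M).-2 != 0.
  rewrite coef_deriv prednK ?ltn_predRL// -[M`__]/(lead_coef M) (monicP Mm).
  rewrite -(fmorph_eq0 iota) rmorph_nat pnatr_eq0 -lt0n.
  by rewrite ltn_predRL.
by rewrite dM0 coef0 eqxx.
Qed.

(* Pseudo-division by P0, whose leading coefficient is e, gives
   e ^+ k *: A = D * P0 + B, and B = 0 by minimality. *)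
Lemma relation_propagates z e (P0 A : {poly {mpoly rat[r]}}) (s : 'rV[K]_r) w :
  e != 0 -> minimal_over t_free z (over_denom e P0) ->
  (map_poly (evalQ t) A).[z] = 0 -> evalQ s e != 0 ->
  (map_poly (evalQ s) P0).[w] = 0 -> (map_poly (evalQ s) A).[w] = 0.
Proof.
move=> e0 [Mm Mz Mmin] Az es Pw.
have qinj : injective (@qfrac r).
  by move=> p q /eqP; rewrite -subr_eq0 -rmorphB qfrac_eq0 subr_eq0 => /eqP.
have e0' : (qfrac e)^-1 != 0 by rewrite invr_eq0 qfrac_eq0.
(* Since [M] is monic, pseudo-division multiplies only by powers of [e], which does not vanish at
   [s]. *)
have lP : lead_coef P0 = e.
  apply: (qinj); move/monicP: Mm; rewrite lead_coefZ.
  rewrite (lead_coef_map_inj qinj (rmorph0 _)) => lP.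
  by rewrite -[LHS](mulVKf (x := qfrac e)) ?qfrac_eq0// lP mulr1.
have P00 : P0 != 0 by rewrite -lead_coef_eq0 lP.
have divA := Pdiv.ComRing.rdivp_eq P0 A.
set k := Pdiv.Ring.rscalp A P0 in divA; set D := Pdiv.Ring.rdivp A P0 in divA.
set B := Pdiv.Ring.rmodp A P0 in divA.
have evA (u : 'rV[K]_r) v : evalQ u e ^+ k * (map_poly (evalQ u) A).[v] =
    (map_poly (evalQ u) D).[v] * (map_poly (evalQ u) P0).[v] +
    (map_poly (evalQ u) B).[v].
  have := congr1 (fun W => (map_poly (evalQ u) W).[v]) divA.
  by rewrite /= lP map_polyZ hornerZ rmorphXn rmorphD rmorphM hornerD hornerM.
have Pz : (map_poly (evalQ t) P0).[z] = 0.
  move: Mz; rewrite frac_emb_over_denom// rootZ; first by move/rootP.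
  by rewrite invr_eq0 evalQ_neq0.
have B0 : B = 0.
  apply/eqP; apply: contraT => B0.
  have Bq : map_poly (@qfrac r) B != 0.
    by rewrite -size_poly_eq0 (size_map_inj_poly qinj (rmorph0 _)) size_poly_eq0.
  have := Mmin _ Bq; rewrite size_scale// !(size_map_inj_poly qinj (rmorph0 _)).
  rewrite leqNgt Pdiv.Ring.ltn_rmodp P00 => /(_ _)/negP; case=> //.
  rewrite rootE -map_poly_comp.
  have -> : map_poly (iota \o @qfrac r) B = map_poly (evalQ t) B.
    by apply: eq_map_poly => p /=; exact: frac_emb_qfrac.
  by have := evA t z; rewrite Az Pz !mulr0 add0r => <-.
have := evA s w; rewrite Pw B0 rmorph0 horner0 mulr0 addr0 => /eqP.
by rewrite mulf_eq0 expf_eq0 (negbTE es) andbF => /eqP.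
Qed.

End SimpleRoot.

(** * Assembly of the parametrization *)

Section Main.
Variable K : numFieldType.
Hypothesis Kcomplete : geometric_complete K.
Hypothesis Karchi : geometric_archimedean K.
Hypothesis Kconnected : forall r (a : 'rV[K]_r) rho, connected (ball a rho).

Theorem parametrization m (y : 'rV[K]_m) r (t : 'rV[K]_r) (z : K) (d : nat) :
  primitive_presentation (adjoin (Qset K) (entries y)) t z d ->
  exists (U : set 'rV[K]_r) (Y : 'I_m -> {poly Qfrac r}) (zf : 'rV[K]_r -> K),
      [/\ [/\ open U, connected U & U t],
          (forall s, U s -> forall j, poly_regular_at (Y j) s),
          QA U zf,
          z = zf t /\ y = \row_j poly_frac_eval (Y j) t z
        & (forall (p : nat) (f : 'I_p -> {mpoly rat[m]}),
            (forall k, mevalQ (f k) y = 0) ->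
            forall s, U s -> forall k,
              mevalQ (f k) (\row_j poly_frac_eval (Y j) s (zf s)) = 0)
          /\ function_degree U zf d].
Proof.
move=> [t_free /(degree_overP t_free)[M Mmin sM]].
rewrite (adjoin_range t_free) (adjoin_root Mmin) => yE.
have /boolp.choice[Y YP] j : exists Yj, poly_frac_eval Yj t z = y 0 j.
  have : adjoin (Qset K) (entries y) (y 0 j) by apply: sub_adjoin_gen; exists j.
  by rewrite yE => -[Yj _ Ej]; exists Yj.
(* The index [None] adds [M] to the family, so that [M] and the coordinates share the denominator
   [e]. *)
have [e e0 [G GP]] := over_denom_family
  (fun i : option 'I_m => if i is Some j then Y j else M).
have YG j : Y j = over_denom e (G (Some j)) := GP (Some j).
have MG : M = over_denom e (G None) := GP None.
set P0 := G None in MG; pose P := map_poly (map_mpoly ratr) P0 : {poly {mpoly K[r]}}.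
have evP s : map_poly (evalK s) P = map_poly (evalQ s) P0 := evalK_map_ratr s P0.
have et := evalQ_neq0 t_free e0.
have Mt : map_poly (frac_emb t_free) M = (evalQ t e)^-1 *: map_poly (evalK t) P.
  by rewrite evP MG frac_emb_over_denom.
have Ptz : (map_poly (evalK t) P).[z] = 0.
  have [_ Mz _] := Mmin; move: Mz; rewrite Mt rootZ ?invr_eq0//.
  by move/rootP.
have dPtz : (map_poly (evalK t) P)^`().[z] != 0.
  have := minimal_simple_root Mmin; rewrite Mt derivZ hornerZ.
  by rewrite mulf_eq0 negb_or => /andP[].
have [rho1 [zf [rho1_gt0 zft zfP zf_analytic]]] :=
  implicit_analytic Kcomplete Karchi Ptz dPtz.
have [rho2 rho2_gt0 e_neq0] := evalK_neq0_ball et.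
have [rho [rho_gt0 rho_le1 rho_le2]] : exists rho,
    [/\ 0 < rho, rho <= rho1 & rho <= rho2].
  (* Positive elements of [K] are real, hence comparable. *)
  have [le12|/ltW le21] := real_leP (gtr0_real rho1_gt0) (gtr0_real rho2_gt0).
    by exists rho1.
  by exists rho2.
pose U : set 'rV[K]_r := ball t rho.
have U1 : U `<=` ball t rho1 := le_ball rho_le1.
have Ue s : U s -> evalQ s e != 0 by move=> /(le_ball rho_le2)/e_neq0.
have Uo : open U := ball_open _ _.
have Ut : U t := ballxx _ rho_gt0.
have P0s s : U s -> (map_poly (evalQ s) P0).[zf s] = 0 by move=> /U1/zfP; rewrite evP.
exists U, Y, zf; split.
- by split=> //; exact: Kconnected.
- by move=> s /Ue es j; rewrite YG; exact: over_denom_regular.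
- split; first split; first exact: zf_analytic.
    move=> a Ua; exists U; split=> //; exists P; last by move=> s /U1/zfP.
    by apply: contra_neq dPtz => ->; rewrite rmorph0 deriv0 horner0.
  move=> a Ua; exists U; split=> //; exists P0; last exact: P0s.
  apply: contra_neq dPtz => P00.
  by rewrite evP P00 rmorph0 deriv0 horner0.
- split=> //; apply/rowP => j; by rewrite mxE YP.
split=> [p f fy s Us k|].
  have [A [N AP]] := @clear_denominators K r m e (fun j => G (Some j)) (f k).
  have Yrow u v : evalQ u e != 0 -> \row_j poly_frac_eval (Y j) u v =
      \row_j ((map_poly (evalQ u) (G (Some j))).[v] / evalQ u e) :> 'rV[K]_m.
    by move=> ue; apply/rowP => j; rewrite !mxE YG over_denom_eval.
  rewrite -/(evalQ _ _) Yrow ?Ue// AP ?Ue//.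
  rewrite (@relation_propagates K r t t_free z e P0 A) ?mul0r ?Ue ?P0s// -?MG//.
  have := fy k; have -> : y = \row_j poly_frac_eval (Y j) t z.
    by apply/rowP => j; rewrite mxE YP.
  rewrite -/(evalQ _ _) Yrow// AP// => /eqP.
  by rewrite mulf_eq0 invr_eq0 expf_eq0 (negbTE et) andbF orbF => /eqP.
split.
  exists M; split; [by have [] := Mmin| |exact: sM].
  by move=> s Us _; rewrite MG over_denom_eval ?Ue// P0s// mul0r.
move=> p Ip p0; rewrite -sM; have [_ _] := Mmin; apply => //.
(* By independence [t] is not a pole of any coefficient, so the relation may be tested there; it
   then annihilates [z], and minimality of [M] applies. *)
have := Ip t Ut; rewrite zft => h; apply/eqP; apply: h => i.
have [n [q [q0 ->]]] := qfrac_repr p`_i.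
by exists (evalQ t n / evalQ t q), n, q; split=> //; exact: evalQ_neq0.
Qed.

End Main.

Theorem theorem4 (R : realType) (K : numFieldType)
  (hK : K = (R : numFieldType) \/ K = (R[i] : numFieldType))
  (m : nat) (y : 'rV[K]_m)
  (hy : ~ (forall j, algebraicOver (ratr : rat -> K) (y 0 j))) :
  (exists (r : nat) (t : 'rV[K]_r) (z : K) (d : nat),
    primitive_presentation (adjoin (Qset K) (entries y)) t z d) /\
  (forall (r : nat) (t : 'rV[K]_r) (z : K) (d : nat),
    primitive_presentation (adjoin (Qset K) (entries y)) t z d ->
    exists (U : set 'rV[K]_r) (Y : 'I_m -> {poly Qfrac r}) (zf : 'rV[K]_r -> K),
      [/\ [/\ open U, connected U & U t],
          (forall s, U s -> forall j, poly_regular_at (Y j) s),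
          QA U zf,
          z = zf t /\ y = \row_j poly_frac_eval (Y j) t z
        & (forall (p : nat) (f : 'I_p -> {mpoly rat[m]}),
            (forall k, mevalQ (f k) y = 0) ->
            forall s, U s -> forall k,
              mevalQ (f k) (\row_j poly_frac_eval (Y j) s (zf s)) = 0)
          /\ function_degree U zf d]).
Proof.
split; first exact: presentation_exists.
move=> r t z d; case: hK => EK; subst K.
  apply: parametrization.
  - exact: real_geometric_complete.
  - exact: real_geometric_archimedean.
  - by move=> *; exact: real_ball_connected.
apply: parametrization.
- exact: complex_geometric_complete.
- exact: complex_geometric_archimedean.
- by move=> *; exact: complex_ball_connected.
Qed.
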